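(* Let $p$ be an odd prime and let $F$ be a field with $\operatorname{char}(F)\ne p$ and $\mu_p\not\subseteq F$. Let $G_F=\mathrm{Gal}(F(p)/F)$. For any $n\in\mathbb N$, $n\geq 1$, the map $H^1(G_F,\widetilde{\mu_{p^n}})\to H^1(G_F,\widetilde{\mu_p})$ induced by the canonical epimorphism $\widetilde{\mu_{p^n}}\to\widetilde{\mu_p}$, $\omega\mapsto\omega^{p^{n-1}}$, is surjective.
   Context: For a field $K$, $K(p)$ denotes the maximal $p$-extension of $K$ (compositum of all finite Galois extensions of $K$ of $p$-power degree). Let $L=F(\mu_p)$, $\mathcal G=\mathrm{Gal}(L(p)/F)$, $G_L=\mathrm{Gal}(L(p)/L)$, $N=\mathrm{Gal}(L(p)/F(p))$, so $G_F=\mathcal G/N$. For each $n$, $\mu_{p^n}\subseteq L(p)$; the cyclotomic character $\alpha:\mathcal G\to(\mathbb Z/p^n\mathbb Z)^*$ is defined by $g(\omega)=\omega^{\alpha(g)}$ for $\omega\in\mu_{p^n}$, and $\theta:\mathcal G\to(\mathbb Z/p^n\mathbb Z)^*$ is the unique character with $\theta|_N=\alpha|_N$ and $\theta|_{G_L}=1$ (namely $\theta=\alpha^{p^{n-1}}$). $\widetilde{\mu_{p^n}}$ denotes the group $\mu_{p^n}$ with the twisted $\mathcal G$-action $g*\omega=g(\omega)^{\theta(g)^{-1}}$; $N$ acts trivially, so this is a $G_F$-module. $\widetilde{\mu_p}$ is the case $n=1$ (equivalently, $\mu_p$ twisted by the reduction mod $p$ of $\theta^{-1}$). Cohomology is continuous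 cohomology. *)

(* Defs.v *)
From HB Require Import structures.
From mathcomp Require Import all_boot all_order all_algebra all_fingroup all_field.
From mathcomp Require Import boolp classical_sets functions filter.
From mathcomp Require Import topology_structure.

Set Implicit Arguments.
Unset Strict Implicit.
Unset Printing Implicit Defensive.

Import GRing.Theory.

Local Open Scope classical_set_scope.
Local Open Scope ring_scope.

Structure subfield (Omega : fieldType) := Subfield {
  subfield_pred :> {pred Omega};
  subfield_closed : divring_closed subfield_pred
}.

HB.instance Definition _ (Omega : fieldType) (K : subfield Omega) :=
  GRing.isDivringClosed.Build Omega (subfield_pred K) (subfield_closed K).

Record subfield_elt (Omega : fieldType) (K : subfield Omega) := SubfieldElt {
  elt_val : Omega;
  elt_valP : elt_val \in K
}.
Coercion subfield_elt : subfield >-> Sortclass.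

Section SubfieldElt.
Variables (Omega : fieldType) (K : subfield Omega).
HB.instance Definition _ := [isSub for @elt_val Omega K].
HB.instance Definition _ := [Choice of subfield_elt K by <:].
HB.instance Definition _ := [SubChoice_isSubIntegralDomain of subfield_elt K by <:].
HB.instance Definition _ := [SubIntegralDomain_isSubField of subfield_elt K by <:].
End SubfieldElt.

Section Generation.
Variable Omega : fieldType.

Lemma generated_closed (A : set Omega) :
  divring_closed
    [pred x : Omega | `[< forall K : subfield Omega, A `<=` [set` K] -> x \in K >]].
Proof.
split.
- by apply: asboolT => K _; exact: rpred1.
- move=> x y /asboolW Hx /asboolW Hy.
  by apply: asboolT => K AK; apply: rpredB; [exact: Hx | exact: Hy].
- move=> x y /asboolW Hx /asboolW Hy.
  by apply: asboolT => K AK; apply: rpred_div; [exact: Hx | exact: Hy].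
Qed.

Definition generated (A : set Omega) : subfield Omega :=
  Subfield (generated_closed A).

Lemma image_closed (F : fieldType) (iota : {rmorphism F -> Omega}) :
  divring_closed (mem (range iota)).
Proof.
split.
- by apply/mem_set; exists 1 => //; rewrite rmorph1.
- move=> x y /set_mem[a _ <-] /set_mem[b _ <-].
  by apply/mem_set; exists (a - b) => //; rewrite rmorphB.
- move=> x y /set_mem[a _ <-] /set_mem[b _ <-].
  by apply/mem_set; exists (a / b) => //; rewrite fmorph_div.
Qed.

Definition image_subfield (F : fieldType) (iota : {rmorphism F -> Omega}) :
  subfield Omega := Subfield (image_closed iota).

(* M is the image in Omega of a finite Galois extension of K of p-power
   degree; x%:A is the image of x : K in its extension E. *)
Definition galois_p_extension (p : nat) (K M : subfield Omega) : Prop :=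
  exists (E : splittingFieldType K) (j : {rmorphism E -> Omega}),
    [/\ forall x : K, j x%:A = val x,
        galois 1%AS {:E}%AS,
        exists k, \dim {:E}%VS = (p ^ k)%N
      & range j = [set` M]].

(* K(p): the compositum inside Omega. *)
Definition max_p_extension (p : nat) (K : subfield Omega) : subfield Omega :=
  generated ([set` K]
    `|` [set x | exists2 M, galois_p_extension p K M & x \in M]).

(* K(mu_m); Omega is meant to contain all m-th roots of unity. *)
Definition adjoin_roots (m : nat) (K : subfield Omega) : subfield Omega :=
  generated ([set` K] `|` [set x | x ^+ m = 1]).

End Generation.

Section Galois.
Variables (Omega : fieldType) (E K : subfield Omega).

(* gal E K is Gal(E/K), for subfields K <= E of Omega. *)
Definition is_gal (f : E -> E) : Prop :=
  [/\ zmod_morphism f, monoid_morphism f, bijective f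
    & forall x : E, val x \in K -> f x = x].

Record gal := Gal { gal_fun :> E -> E; gal_funP : `[< is_gal gal_fun >] }.

HB.instance Definition _ := [isSub for gal_fun].
HB.instance Definition _ := [Choice of gal by <:].

Lemma galP (g : gal) : is_gal g. Proof. exact/asboolP/gal_funP. Qed.

HB.instance Definition _ (g : gal) :=
  GRing.isZmodMorphism.Build E E (gal_fun g) (let: And4 H _ _ _ := galP g in H).
HB.instance Definition _ (g : gal) :=
  GRing.isMonoidMorphism.Build E E (gal_fun g) (let: And4 _ H _ _ := galP g in H).

Lemma gal_eq (g h : gal) : g =1 h -> g = h.
Proof. by move=> gh; apply/val_inj/funext. Qed.

Lemma is_gal_id : is_gal id.
Proof. by split=> //; exists id. Qed.

Lemma is_gal_comp (g h : gal) : is_gal (g \o h).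
Proof.
split.
- by move=> x y /=; rewrite !rmorphB.
- by split=> [|x y] /=; rewrite ?rmorph1 ?rmorphM.
- by apply: bij_comp; [case: (galP g) | case: (galP h)].
- by case: (galP g) => _ _ _ gK; case: (galP h) => _ _ _ hK x Kx /=;
     rewrite hK // gK.
Qed.

Lemma gal_inv_subproof (g : gal) :
  exists f : E -> E, [/\ is_gal f, cancel f g & cancel g f].
Proof.
case: (galP g) => _ _ [f gf fg] gK; exists f; split=> //; split.
- by move=> x y; rewrite -[x in LHS]fg -[y in LHS]fg -rmorphB gf.
- split=> [|x y]; first by rewrite -[1 in LHS](rmorph1 g) gf.
  by rewrite -[x in LHS]fg -[y in LHS]fg -rmorphM gf.
- by exists g.
- by move=> x Kx; rewrite -[x in LHS](gK x Kx) gf.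
Qed.

Definition gal_one : gal := Gal (asboolT is_gal_id).
Definition gal_mul (g h : gal) : gal := Gal (asboolT (is_gal_comp g h)).
Definition gal_inv (g : gal) : gal :=
  let: exist f fP := cid (gal_inv_subproof g) in
  Gal (asboolT (let: And3 H _ _ := fP in H)).

Lemma gal_mulA : associative gal_mul.
Proof. by move=> f g h; apply: gal_eq. Qed.
Lemma gal_mul1 : left_id gal_one gal_mul.
Proof. by move=> f; apply: gal_eq. Qed.
Lemma gal_1mul : right_id gal_one gal_mul.
Proof. by move=> f; apply: gal_eq. Qed.
Lemma gal_mulV : left_inverse gal_one gal_inv gal_mul.
Proof.
move=> g; apply: gal_eq => x; rewrite /gal_inv /=.
by case: cid => f [fK gf fg] /=; rewrite fg.
Qed.
Lemma gal_Vmul : right_inverse gal_one gal_inv gal_mul.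
Proof.
move=> g; apply: gal_eq => x; rewrite /gal_inv /=.
by case: cid => f [fK gf fg] /=; rewrite gf.
Qed.

HB.instance Definition _ :=
  isGroup.Build gal gal_mulA gal_mul1 gal_1mul gal_mulV gal_Vmul.

(* Krull topology: the basic neighbourhoods of s are the cosets
   s * Gal(E/K(e)), where e is a finite sequence of elements of E. *)
Definition krull_nbhs (s : gal) : set_system gal :=
  [set A | exists e : seq E, forall t : gal, {in e, t =1 s} -> A t].

HB.instance Definition _ := hasNbhs.Build gal krull_nbhs.

Lemma krull_filter (s : gal) : ProperFilter (nbhs s).
Proof.
apply: Build_ProperFilter_ex.
  by move=> A [e eA]; exists s; apply: eA.
split.
- by exists [::].
- move=> A B [e eA] [e' eB]; exists (e ++ e') => t te; split.
    by apply: eA => x xe; apply: te; rewrite mem_cat xe.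
  by apply: eB => x xe; apply: te; rewrite mem_cat xe orbT.
- by move=> A B AB [e eA]; exists e => t /eA/AB.
Qed.

Lemma krull_singleton (s : gal) (A : set gal) : nbhs s A -> A s.
Proof. by case=> e; apply. Qed.

Lemma krull_nbhs_nbhs (s : gal) (A : set gal) : nbhs s A -> nbhs s (nbhs^~ A).
Proof.
case=> e eA; exists e => t ts; exists e => u ut; apply: eA => x xe.
by rewrite ut // ts.
Qed.

HB.instance Definition _ :=
  Nbhs_isNbhsTopological.Build gal krull_filter krull_singleton krull_nbhs_nbhs.

(* Gal(E/M), as a subset of Gal(E/K). *)
Definition fixing (M : subfield Omega) : set gal :=
  [set g | forall x : E, val x \in M -> g x = x].

End Galois.

#[short(type="topGroupType")]
HB.structure Definition TopGroup := {G of monoid.Group G & Topological G}.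

HB.instance Definition _ (Omega : fieldType) (E K : subfield Omega) :=
  Topological.on (gal E K).

Section Cohomology.
Local Open Scope group_scope.
Variable G : topGroupType.

(* Modules are written multiplicatively and carry the discrete topology, so
   continuous cochains are the locally constant ones. *)
Definition is_cocycle (M : groupType) (act : G -> M -> M) (c : G -> M) : Prop :=
  (forall s, \forall t \near s, c t = c s)
  /\ forall s t, c (s * t) = c s * act s (c t).

Definition cohomologous (M : groupType) (act : G -> M -> M) (c d : G -> M) :
  Prop := exists m : M, forall s, d s = c s * (act s m * m^-1).

Definition cohomology_class (M : groupType) (act : G -> M -> M) (c : G -> M) :
  set (G -> M) := [set d | is_cocycle act d /\ cohomologous act c d].

(* H^1(G, M) as the set of classes of continuous cocycles. *)
Definition H1 (M : groupType) (act : G -> M -> M) : set (set (G -> M)) :=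
  [set cohomology_class act c | c in is_cocycle act].

(* [c] |-> [f \o c]; for f equivariant, the union is a single class. *)
Definition H1_map (M M' : groupType) (act' : G -> M' -> M') (f : M -> M')
  (xi : set (G -> M)) : set (G -> M') :=
  \bigcup_(c in xi) cohomology_class act' (f \o c).

End Cohomology.

Section RootsOfUnity.
Variables (E : fieldType) (m : nat).

Record mu := Mu {
  mu_val : E;
  mu_valP : (mu_val \is a GRing.unit) && (mu_val ^+ m == 1)
}.

HB.instance Definition _ := [isSub for mu_val].
HB.instance Definition _ := [Choice of mu by <:].

Lemma mu_one_subproof : ((1 : E) \is a GRing.unit) && ((1 : E) ^+ m == 1).
Proof. by rewrite unitr1 expr1n eqxx. Qed.
Lemma mu_mul_subproof (x y : mu) :
  (mu_val x * mu_val y \is a GRing.unit)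
  && ((mu_val x * mu_val y) ^+ m == 1).
Proof.
case: x y => x /= /andP[ux /eqP xm] [y /= /andP[uy /eqP ym]].
by rewrite unitrM ux uy exprMn xm ym mulr1 /=.
Qed.
Lemma mu_inv_subproof (x : mu) :
  ((mu_val x)^-1 \is a GRing.unit) && ((mu_val x)^-1 ^+ m == 1).
Proof.
by case: x => x /= /andP[ux /eqP xm]; rewrite unitrV ux exprVn xm invr1 /=.
Qed.

Definition mu_one : mu := Mu mu_one_subproof.
Definition mu_mul (x y : mu) : mu := Mu (mu_mul_subproof x y).
Definition mu_inv (x : mu) : mu := Mu (mu_inv_subproof x).

Lemma mu_mulA : associative mu_mul.
Proof. by move=> x y z; apply/val_inj; rewrite /= mulrA. Qed.
Lemma mu_mul1 : left_id mu_one mu_mul.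
Proof. by move=> x; apply/val_inj; rewrite /= mul1r. Qed.
Lemma mu_1mul : right_id mu_one mu_mul.
Proof. by move=> x; apply/val_inj; rewrite /= mulr1. Qed.
Lemma mu_mulV : left_inverse mu_one mu_inv mu_mul.
Proof.
by move=> x; apply/val_inj; case: x => x /= /andP[ux _]; rewrite mulVr.
Qed.
Lemma mu_Vmul : right_inverse mu_one mu_inv mu_mul.
Proof.
by move=> x; apply/val_inj; case: x => x /= /andP[ux _]; rewrite mulrV.
Qed.

HB.instance Definition _ :=
  isGroup.Build mu mu_mulA mu_mul1 mu_1mul mu_mulV mu_Vmul.

End RootsOfUnity.

Section PowerMap.
Variables (E : fieldType) (p n : nat).
Hypothesis n_gt0 : (0 < n)%N.

Lemma mu_epi_subproof (x : mu E (p ^ n)) :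
  (mu_val x ^+ (p ^ n.-1) \is a GRing.unit)
  && ((mu_val x ^+ (p ^ n.-1)) ^+ (p ^ 1) == 1).
Proof.
case: x => x /= /andP[ux /eqP xm].
by rewrite unitrX // -exprM -expnD addn1 prednK // xm /=.
Qed.

Definition mu_epi (x : mu E (p ^ n)) : mu E (p ^ 1) := Mu (mu_epi_subproof x).

End PowerMap.

Lemma gal_mu_subproof (Omega : fieldType) (E K : subfield Omega) (m : nat)
  (g : gal E K) (x : mu E m) :
  (g (mu_val x) \is a GRing.unit) && (g (mu_val x) ^+ m == 1).
Proof.
case: x => x /= /andP[ux /eqP xm].
by rewrite rmorph_unit // -rmorphXn xm rmorph1 /=.
Qed.

Definition gal_mu (Omega : fieldType) (E K : subfield Omega) (m : nat)
  (g : gal E K) (x : mu E m) : mu E m := Mu (gal_mu_subproof g x).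

Section Twist.
Local Open Scope group_scope.
Variables (Omega : fieldType) (p : nat) (F : subfield Omega) (n : nat).

Let L := adjoin_roots p F.
Let Lp := max_p_extension p L.
Let Fp := max_p_extension p F.

(* The cyclotomic character alpha : Gal(L(p)/F) -> (Z/p^n)^*. *)
Definition cyclotomic (g : gal Lp F) : {unit 'Z_(p ^ n)} :=
  xget 1 [set a : {unit 'Z_(p ^ n)} |
    forall w : mu Lp (p ^ n), gal_mu g w = w ^+ (val a : 'Z_(p ^ n))].

(* The unique character which is alpha on N = Gal(L(p)/F(p)) and is trivial
   on Gal(L(p)/L). *)
Definition is_theta (chi : gal Lp F -> {unit 'Z_(p ^ n)}) : Prop :=
  [/\ {morph chi : g h / g * h},
      forall g, fixing Fp g -> chi g = cyclotomic g
    & forall g, fixing L g -> chi g = 1].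

Definition theta : gal Lp F -> {unit 'Z_(p ^ n)} := xget (fun=> 1) is_theta.

Definition twisted_action (g : gal Lp F) (w : mu Lp (p ^ n)) : mu Lp (p ^ n) :=
  gal_mu g w ^+ (val (theta g)^-1 : 'Z_(p ^ n)).

Definition lift (s : gal Fp F) : gal Lp F :=
  xget 1 [set g : gal Lp F | forall (x : Lp) (y : Fp), val x = val y ->
                    val (g x) = val (s y)].

(* Every s extends to L(p), and N acts trivially on the twisted module, so this
   action of G_F = Gal(F(p)/F) does not depend on the chosen lifts. *)
Definition twisted_mu_action (s : gal Fp F) (w : mu Lp (p ^ n)) :
  mu Lp (p ^ n) := twisted_action (lift s) w.

End Twist.

(* Main.v *)
(* Put L = F(mu_p), G = Gal(L(p)/F), G_L = Gal(L(p)/L) and N = Gal(L(p)/F(p)).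
   A class in H^1(G_F, ~mu_p) is a continuous character c : G_F -> mu_p, since
   the twisted action on mu_p is trivial.  By Kummer theory c restricted to G_L
   is g |-> g(b)/b for some b in L(p) with b^p in L; if B^(p^(n-1)) = b then
   B lies in L(p) and g |-> g(B)/B is a cocycle on G_L with values in mu_(p^n)
   which lifts it.  As theta is trivial on G_L, this cocycle can be transferred
   from G_L to G for the twisted action; on mu_p transfer after restriction is
   multiplication by [L : F], which is prime to p, so a suitable power C of the
   transferred cocycle lifts c.  Finally C and the twisted action define a
   morphism from G to a finite p-group; its kernel contains N, so C descends to
   G_F.

   The field theory rests on a pointwise description of K(p): x lies in K(p) iff
   x is separable over K and every K-automorphism of the algebraic closure has a
   p-power which fixes x. *)
From HB Require Import structures.
Require Import Defs.
From mathcomp Require Import all_boot all_order all_algebra all_fingroup all_solvable all_field.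
From mathcomp Require Import boolp classical_sets functions filter.
Import Defs.

Set Implicit Arguments.
Unset Strict Implicit.
Unset Printing Implicit Defensive.

Import GRing.Theory.

Local Open Scope classical_set_scope.
Local Open Scope ring_scope.

(** * The action of Gal(E/K) on the ambient field *)

(** Kummer theory needs mu_p in the base field, so it applies over L only, and the difficulty is to
    return to G_F. A transferred cocycle for the untwisted action could not descend, because N maps
    onto Gal(L/F) and moves the roots of unity. The twist removes exactly this: every g in G is a
    product of an element of N and one of G_L, and g acts on the twisted module as its G_L part acts
    by Galois. So G acts through a p-group, while over L nothing changes. The exponent of theta =
    alpha^(p^(n-1)) fits because p^(n-1) is 1 modulo p - 1, which kills alpha on N, and annihilates
    the p-power part of (Z/p^n)^*, which contains the image of G_L.

    The compositum defining K(p) shows neither its stability under automorphisms nor its closure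
    under p-th roots; both are short from the pointwise criterion. Open subgroups and continuity are
    expressed by finite sequences e: a property holds of every g that fixes e. All extensions and
    restrictions of automorphisms go through one algebraic closure A of F in Omega. *)

Section Subfields.
Variable Omega : fieldType.
Implicit Types (K M E : subfield Omega) (x y : Omega) (P : {poly Omega}).

Lemma generated_incl (B : set Omega) x : B x -> x \in generated B.
Proof. by move=> Bx; apply/asboolP => K; apply. Qed.

Lemma generated_min (B : set Omega) K :
  B `<=` [set` K] -> {subset generated B <= K}.
Proof. by move=> BK x /asboolP; apply. Qed.

Lemma polyOver_lift K P :
  P \is a polyOver K -> exists f : {poly K}, P = map_poly val f.
Proof.
move=> /polyOverP KP; exists (\poly_(i < size P) SubfieldElt (KP i)).
apply/polyP => i; rewrite coef_map coef_poly.
case: ltnP => [//|/(nth_default 0) ->]. by rewrite raddf0.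
Qed.

Lemma polyOver_val K (f : {poly K}) : map_poly val f \is a polyOver K.
Proof. by apply/polyOverP => i; rewrite coef_map; exact: elt_valP. Qed.

Lemma polyOver_sub K M P :
  {subset K <= M} -> P \is a polyOver K -> P \is a polyOver M.
Proof. by move=> KM /polyOverP KP; apply/polyOverP => i; exact/KM. Qed.

Definition alg_pred K : pred Omega :=
  fun x => `[< algebraicOver (val : K -> Omega) x >].

Lemma alg_closed K : divring_closed (alg_pred K).
Proof.
split.
- exact/asboolP/algebraic1.
- move=> x y /asboolP ax /asboolP ay; exact/asboolP/algebraic_sub.
- move=> x y /asboolP ax /asboolP ay; exact/asboolP/algebraic_div.
Qed.

Definition alg_closure K : subfield Omega := Subfield (alg_closed K).

Lemma alg_closureP K x :
  reflect (exists P, [/\ P \is a polyOver K, P != 0 & root P x])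
          (x \in alg_closure K).
Proof.
apply: (iffP idP) => [/asboolP [f f0 fx]|[P [KP P0 Px]]].
  by exists (map_poly val f); rewrite polyOver_val map_poly_eq0.
have [f fE] := polyOver_lift KP; apply/asboolP; exists f; last by rewrite -fE.
by rewrite -(map_poly_eq0 val) -fE.
Qed.

Lemma sub_alg_closure K : {subset K <= alg_closure K}.
Proof.
move=> x Kx; apply/alg_closureP; exists ('X - x%:P).
by rewrite polyOverXsubC Kx polyXsubC_eq0 root_XsubC.
Qed.

Lemma alg_closure_trans K M x : {subset M <= alg_closure K} ->
  x \in alg_closure M -> x \in alg_closure K.
Proof.
move=> MA /alg_closureP[P [/polyOverP MP P0 Px]]; apply/asboolP.
apply/integral_algebraic; apply: integral_root P0 Px _.
by move=> y /(nthP 0) [i _ <-]; apply/integral_algebraic/asboolP/MA.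
Qed.

End Subfields.

Section Action.
Variables (Omega : fieldType) (E K : subfield Omega).
Implicit Types (g h : gal E K) (x y : Omega).

(* Junk value: ev g is the identity outside E. *)
Definition ev g x : Omega := if insub x is Some y then val (g y) else x.

Lemma ev_val g (y : E) : ev g (val y) = val (g y).
Proof. by rewrite /ev valK. Qed.

Lemma ev_out g x : x \notin E -> ev g x = x.
Proof. by move=> Ex; rewrite /ev insubN. Qed.

Lemma ev_in g x : x \in E -> ev g x \in E.
Proof. by move=> Ex; rewrite (ev_val g (SubfieldElt Ex)) elt_valP. Qed.

Lemma evM g h x : ev (g * h)%g x = ev g (ev h x).
Proof.
have [Ex|Ex] := boolP (x \in E); last by rewrite !ev_out.
by rewrite -[x]/(val (SubfieldElt Ex)) !ev_val.
Qed.

Lemma ev1 x : ev (1%g : gal E K) x = x.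
Proof.
have [Ex|Ex] := boolP (x \in E); last by rewrite ev_out.
by rewrite -[x]/(val (SubfieldElt Ex)) !ev_val.
Qed.

Lemma evK g : cancel (ev g) (ev g^-1%g).
Proof. by move=> x; rewrite -evM mulVg ev1. Qed.

Lemma evVK g : cancel (ev g^-1%g) (ev g).
Proof. by move=> x; rewrite -evM mulgV ev1. Qed.

Lemma ev_inj g : injective (ev g). Proof. exact: can_inj (evK g). Qed.

Lemma ev_fixV g x : ev g x = x -> ev g^-1%g x = x.
Proof. by move=> gx; rewrite -[in LHS]gx evK. Qed.

Lemma ev_ext g h : {in E, ev g =1 ev h} -> g = h.
Proof. by move=> gh; apply: gal_eq => x; apply: val_inj; rewrite -!ev_val gh // elt_valP. Qed.

Lemma evX g n x : ev (g ^+ n)%g x = iter n (ev g) x.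
Proof. by elim: n => [|n IHn]; rewrite ?expg0 ?ev1 // expgS evM IHn. Qed.

Lemma ev_fixX g n x : ev g x = x -> ev (g ^+ n)%g x = x.
Proof. by rewrite evX => gx; elim: n => //= n ->. Qed.

Lemma ev_fix_leq p g x a b : (a <= b)%N ->
  ev (g ^+ (p ^ a))%g x = x -> ev (g ^+ (p ^ b))%g x = x.
Proof. by move=> ab gx; rewrite -(subnKC ab) expnD expgM ev_fixX. Qed.

(** Moves torsion from x to its translate by h, which is why K(p) is stable under automorphisms. *)
Lemma ev_conj_fix p g h x a : ev ((h^-1 * g * h) ^+ (p ^ a))%g x = x ->
  ev (g ^+ (p ^ a))%g (ev h x) = ev h x.
Proof.
move=> ga; apply: (can_inj (evVK h)); rewrite evK -[RHS]ga.
have -> : (h^-1 * g * h = g ^ h)%g by rewrite conjgE mulgA.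
by rewrite -conjXg conjgE !evM.
Qed.

Lemma evB g x y : x \in E -> y \in E -> ev g (x - y) = ev g x - ev g y.
Proof.
move=> Ex Ey; rewrite -[x]/(val (SubfieldElt Ex)) -[y]/(val (SubfieldElt Ey)).
by rewrite -rmorphB !ev_val !rmorphB.
Qed.

Lemma ev_mul g x y : x \in E -> y \in E -> ev g (x * y) = ev g x * ev g y.
Proof.
move=> Ex Ey; rewrite -[x]/(val (SubfieldElt Ex)) -[y]/(val (SubfieldElt Ey)).
by rewrite -rmorphM !ev_val !rmorphM.
Qed.

Lemma ev_0 g : ev g 0 = 0.
Proof. by have := ev_val g 0; rewrite !raddf0. Qed.

Lemma ev_1 g : ev g 1 = 1.
Proof. by have := ev_val g 1; rewrite !rmorph1. Qed.

Lemma ev_N g x : x \in E -> ev g (- x) = - ev g x.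
Proof. by move=> Ex; rewrite -[- x]sub0r evB ?rpred0 // ev_0 sub0r. Qed.

Lemma evD g x y : x \in E -> y \in E -> ev g (x + y) = ev g x + ev g y.
Proof. by move=> Ex Ey; rewrite -{1}[y]opprK evB ?rpredN // ev_N // opprK. Qed.

Lemma ev_V g x : ev g x^-1 = (ev g x)^-1.
Proof.
have [Ex|Ex] := boolP (x \in E); last by rewrite !ev_out // rpredV.
have [->|x0] := eqVneq x 0; first by rewrite !(invr0, ev_0).
have gx0 : ev g x != 0 by rewrite -(ev_0 g) (inj_eq (@ev_inj g)).
by apply: (mulIf gx0); rewrite -ev_mul ?rpredV // !mulVf // ev_1.
Qed.

Lemma ev_exp g x n : x \in E -> ev g (x ^+ n) = ev g x ^+ n.
Proof.
move=> Ex; elim: n => [|n IHn]; first by rewrite !expr0 ev_1.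
by rewrite !exprS ev_mul ?rpredX // IHn.
Qed.

Lemma ev_fix g x : x \in K -> ev g x = x.
Proof.
move=> Kx; have [Ex|Ex] := boolP (x \in E); last exact: ev_out.
by rewrite -[x]/(val (SubfieldElt Ex)) ev_val; case: (galP g) => _ _ _ ->.
Qed.

Lemma ev_sum g I (r : seq I) (f : I -> Omega) : (forall i, f i \in E) ->
  ev g (\sum_(i <- r) f i) = \sum_(i <- r) ev g (f i).
Proof.
move=> Ef; elim: r => [|i r IHr]; first by rewrite !big_nil ev_0.
by rewrite !big_cons evD ?rpred_sum // IHr.
Qed.

Lemma ev_horner g (P : {poly Omega}) x : x \in E -> P \is a polyOver E ->
  (forall i, ev g P`_i = P`_i) -> ev g P.[x] = P.[ev g x].
Proof.
move=> Ex /polyOverP EP gP; rewrite !horner_coef ev_sum; last first.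
  by move=> i; rewrite rpredM ?rpredX.
by apply: eq_bigr => i _; rewrite ev_mul ?rpredX // gP ev_exp.
Qed.

Lemma ev_root g (P : {poly Omega}) x : x \in E -> P \is a polyOver E ->
  (forall i, ev g P`_i = P`_i) -> root P x -> root P (ev g x).
Proof. by move=> Ex EP gP /rootP Px; apply/rootP; rewrite -ev_horner // Px ev_0. Qed.

(** Both maps live on the ambient field, so that candidates given pointwise, such as limits of
    powers of g, fit directly. *)
Lemma gal_build (f f' : Omega -> Omega) :
    {in E, forall x, f x \in E} -> {in E, forall x, f' x \in E} ->
    {in E, cancel f f'} -> {in E, cancel f' f} ->
    {in E &, forall x y, f (x - y) = f x - f y} ->
    {in E &, forall x y, f (x * y) = f x * f y} -> f 1 = 1 ->
    {in K, forall x, f x = x} ->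
  exists g : gal E K, {in E, ev g =1 f}.
Proof.
move=> Ef Ef' fK f'K fB fM f1 fF.
pose u (x : E) : E := SubfieldElt (Ef _ (elt_valP x)).
pose u' (x : E) : E := SubfieldElt (Ef' _ (elt_valP x)).
have gu : is_gal K u.
  split.
  - by move=> x y; apply: val_inj; rewrite /= fB ?elt_valP.
  - by split=> [|x y]; apply: val_inj; rewrite /= ?f1 ?fM ?elt_valP.
  - by exists u' => x; apply: val_inj; rewrite /= ?fK ?f'K ?elt_valP.
  - by move=> x Kx; apply: val_inj; rewrite /= fF.
exists (Gal (asboolT gu)) => x Ex.
by rewrite -[x in LHS]/(val (SubfieldElt Ex)) ev_val.
Qed.

End Action.

(** * Extending partial embeddings to the algebraic closure *)

Section Extension.
Variables (Omega : closedFieldType) (F : subfield Omega).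
Local Notation A := (alg_closure F).
Implicit Types (G H : set (Omega * Omega)) (x y z w : Omega).
Implicit Types (P Q : {poly Omega}).

(* Graphs of ring morphisms over F from subrings of A containing F to Omega. *)
Definition partial_embedding G : Prop :=
  [/\ {in F, forall a, G (a, a)},
      forall x y z w, G (x, y) -> G (z, w) -> G (x - z, y - w),
      forall x y z w, G (x, y) -> G (z, w) -> G (x * z, y * w),
      forall y, G (0, y) -> y = 0
    & forall x y, G (x, y) -> x \in A].

Section Graph.
Variable G : set (Omega * Omega).
Hypothesis GP : partial_embedding G.

Let Gdiag : {in F, forall a, G (a, a)}. Proof. by case: GP. Qed.
Let GB x y z w : G (x, y) -> G (z, w) -> G (x - z, y - w).
Proof. by case: GP => _ + _ _ _; apply. Qed.
Let GM x y z w : G (x, y) -> G (z, w) -> G (x * z, y * w).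
Proof. by case: GP => _ _ + _ _; apply. Qed.
Let Gfun y : G (0, y) -> y = 0. Proof. by case: GP => _ _ _ + _; apply. Qed.
Let Gdom x y : G (x, y) -> x \in A. Proof. by case: GP => _ _ _ _ +; apply. Qed.

Let G0 : G (0, 0). Proof. by apply: Gdiag; rewrite rpred0. Qed.

Let GD x y z w : G (x, y) -> G (z, w) -> G (x + z, y + w).
Proof.
move=> Gxy Gzw; rewrite -[z]opprK -[w]opprK; apply: GB => //.
by rewrite -[- z]sub0r -[- w]sub0r; apply: GB.
Qed.

Lemma partial_embedding_eq x y z : G (x, y) -> G (x, z) -> y = z.
Proof.
move=> Gxy Gxz; have := GB Gxy Gxz; rewrite subrr => /Gfun/eqP.
by rewrite subr_eq0 => /eqP.
Qed.

Let GX P Q := forall i, G (P`_i, Q`_i).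

Let GXB P Q P' Q' : GX P Q -> GX P' Q' -> GX (P - P') (Q - Q').
Proof. by move=> GPQ GPQ' i; rewrite !coefB; apply: GB. Qed.

Let GXM P Q P' Q' : GX P Q -> GX P' Q' -> GX (P * P') (Q * Q').
Proof.
move=> GPQ GPQ' i; rewrite !coefM.
by elim/big_ind2: _ => [||j _]; [| move=> ? ? ? ?; exact: GD | apply: GM].
Qed.

Let GXC x y : G (x, y) -> GX x%:P y%:P.
Proof. by move=> Gxy i; rewrite !coefC; case: eqP. Qed.

Let GXX : GX 'X 'X.
Proof. by move=> i; rewrite !coefX; apply: Gdiag; case: eqP; rewrite ?rpred1 ?rpred0. Qed.

Let GX_horner P Q x y : GX P Q -> G (x, y) -> G (P.[x], Q.[y]).
Proof.
move=> GPQ Gxy; rewrite (horner_coef_wide x (leq_maxl _ (size Q))).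
rewrite (horner_coef_wide y (leq_maxr (size P) _)).
elim/big_ind2: _ => [||j _]; [by [] | by move=> ? ? ? ?; exact: GD |].
apply: GM => //; elim: (nat_of_ord j) => [|k IHk].
  by rewrite !expr0; apply: Gdiag; rewrite rpred1.
by rewrite !exprS; apply: GM.
Qed.

(** z is algebraic over F, so its inverse is a polynomial in z over F. Every equation of z over F
    also holds for w, hence the same polynomial computes the inverse of w. Thus partial embeddings
    are injective. *)
Lemma partial_embedding_inv z w : G (z, w) -> z != 0 -> w != 0 /\ G (z^-1, w^-1).
Proof.
move=> Gzw z0.
have [P [FP P0 /rootP Pz]] : exists P, [/\ P \is a polyOver F, P`_0 != 0 & root P z].
  have [P [FP P0 Pz]] := alg_closureP _ _ (Gdom Gzw).
  (* Dividing by X keeps the root z, since z is non-zero, until the constant term no longer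
     vanishes. *)
  elim: {P}(size P) {-2}P (leqnn (size P)) FP P0 Pz => [|n IHn] P.
    by rewrite leqn0 size_poly_eq0 => ->.
  have [c0|] := eqVneq P`_0 0; last by exists P.
  have PE : P = drop_poly 1 P * 'X.
    rewrite -[LHS](poly_take_drop 1) expr1; apply/eqP.
    rewrite addrC -subr_eq0 addrAC subrr add0r; apply/eqP/polyP => i.
    by rewrite coef_take_poly coef0; case: i => [|i].
  move=> sP FP P0 Pz; apply: (IHn (drop_poly 1 P)).
  - by rewrite size_drop_poly leq_subLR add1n.
  - apply/polyOverP => i; rewrite coef_drop_poly; exact/polyOverP.
  - by apply: contraNneq P0 => d0; rewrite PE d0 mul0r.
  - by move: Pz; rewrite {1}PE rootM rootX (negPf z0) orbF.
have GPP Q : Q \is a polyOver F -> GX Q Q by move=> /polyOverP FQ i; apply: Gdiag.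
have Pw : P.[w] = 0 by apply: Gfun; rewrite -Pz; apply: GX_horner => //; apply: GPP.
pose P' := drop_poly 1 P; pose c := P`_0.
have PE u : P.[u] = c + P'.[u] * u.
  rewrite -[in LHS](poly_take_drop 1 P) expr1 hornerD hornerM hornerX; congr (_ + _).
  rewrite (_ : take_poly 1 P = c%:P) ?hornerC //; apply/polyP => i.
  by rewrite coef_take_poly coefC; case: i.
have P'E u : P.[u] = 0 -> P'.[u] * u = - c.
  by rewrite PE => /eqP; rewrite addrC addr_eq0 => /eqP.
have w0 : w != 0.
  by apply: contraNneq P0 => w0; have := P'E _ Pw; rewrite w0 mulr0 => /eqP; rewrite eq_sym oppr_eq0.
have invE u : u != 0 -> P.[u] = 0 -> u^-1 = - c^-1 * P'.[u].
  move=> u0 /P'E Pu; apply: (mulIf u0); rewrite mulVf // -mulrA Pu.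
  by rewrite mulrNN mulVf.
split=> //; rewrite (invE z) // (invE w) //; apply: GM.
  by apply: Gdiag; rewrite rpredN rpredV; exact/polyOverP.
apply: GX_horner => //; apply: GPP.
by apply/polyOverP => i; rewrite coef_drop_poly; exact/polyOverP.
Qed.

Let GX_eq0 P Q i : GX P Q -> (P`_i == 0) = (Q`_i == 0).
Proof.
move=> GPQ; apply/eqP/eqP => [Pi0|Qi0].
  by apply: Gfun; have := GPQ i; rewrite Pi0.
apply/eqP; apply: contraTT isT => /(partial_embedding_inv (GPQ i)) [].
by rewrite Qi0 eqxx.
Qed.

Let GX_size_le P Q : GX P Q -> (size P <= size Q)%N.
Proof.
move=> GPQ; apply/leq_sizeP => j /(nth_default 0)/eqP.
by rewrite -(GX_eq0 _ GPQ) => /eqP.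
Qed.

Let GX_size P Q : GX P Q -> size P = size Q.
Proof.
move=> GPQ; apply/eqP; rewrite eqn_leq GX_size_le //.
apply/leq_sizeP => j /(nth_default 0)/eqP.
by rewrite (GX_eq0 _ GPQ) => /eqP.
Qed.

(** Take P of least degree with coefficients in the domain and root x, and send x to a root y of the
    image Q of P. Evaluation at (x, y) is then well defined. *)
Lemma partial_embedding_adjoin x : x \in A ->
  exists H y, [/\ partial_embedding H, G `<=` H & H (x, y)].
Proof.
move=> Ax.
pose S n := `[< exists P Q, [/\ GX P Q, P != 0, root P x & size P = n] >].
have exS : exists n, S n.
  have [P [/polyOverP FP P0 Px]] := alg_closureP _ _ Ax.
  by exists (size P); apply/asboolP; exists P, P; split=> // i; apply: Gdiag.
case: (ex_minnP exS) => n /asboolP[P [Q [GPQ P0 Px sP]]] minP.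
have sQ : size Q != 1%N by rewrite -(GX_size GPQ) neq_ltn (root_size_gt1 P0 Px) orbT.
have [y Qy] := closed_rootP _ sQ.
have Q0 : Q != 0 by rewrite -size_poly_eq0 -(GX_size GPQ) size_poly_eq0.
(* Division of R by P, one leading term at a time and in parallel on the images T and Q. By
   minimality of P a non-zero R that vanishes at x is never shorter than P, so the division ends at
   0. *)
have vanish R T : GX R T -> R.[x] = 0 -> T.[y] = 0.
  elim: {R}(size R) {-2}R (leqnn (size R)) T => [|m IHm] R sR T GRT Rx.
    move: sR; rewrite (GX_size GRT) leqn0 size_poly_eq0 => /eqP ->.
    by rewrite horner0.
  have [R0|R0] := eqVneq R 0.
    have /eqP := GX_size GRT; rewrite R0 size_poly0 eq_sym size_poly_eq0 => /eqP ->.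
    by rewrite horner0.
  have T0 : T != 0 by rewrite -size_poly_eq0 -(GX_size GRT) size_poly_eq0.
  have le_PR : (size P <= size R)%N.
    by rewrite sP; apply: minP; apply/asboolP; exists R, T; split=> //; apply/rootP.
  pose k := (size R - size P)%N.
  pose c := lead_coef R / lead_coef P; pose d := lead_coef T / lead_coef Q.
  have Gcd : G (c, d).
    apply: GM; first by rewrite !lead_coefE -(GX_size GRT).
    by case: (@partial_embedding_inv (lead_coef P) (lead_coef Q));
      rewrite ?lead_coef_eq0 // !lead_coefE -(GX_size GPQ).
  have GXk : GX 'X^k 'X^k.
    by elim: k => [|k IHk]; [rewrite !expr0; apply: GXC; apply: Gdiag; rewrite rpred1
                            | rewrite !exprS; apply: GXM].
  pose M1 := c%:P * 'X^k * P; pose M2 := d%:P * 'X^k * Q.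
  have GMM : GX M1 M2 by apply: GXM => //; apply: GXM => //; apply: GXC.
  have Ty : (T - M2).[y] = 0.
    apply: (IHm (R - M1)) => //; last 2 first.
    - exact: GXB.
    - by rewrite hornerD hornerN Rx !hornerM (rootP Px) mulr0 subrr.
    have c0 : c != 0 by rewrite mulf_neq0 ?invr_eq0 ?lead_coef_eq0.
    have sM1 : size M1 = size R.
      rewrite /M1 -mulrA size_Cmul // mulrC size_mulXn //.
      by rewrite /k addnC subnKC.
    rewrite -ltnS; apply: (leq_trans _ sR); rewrite ltn_neqAle.
    have le_RM : (size (R - M1)%R <= size R)%N.
      by rewrite (leq_trans (size_polyD _ _)) // size_polyN sM1 maxnn.
    rewrite le_RM andbT; apply/negP => /eqP sRM.
    have : (R - M1)`_(size R).-1 == 0.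
      rewrite coefB -lead_coefE -sM1 -lead_coefE /M1 !lead_coefM lead_coefC.
      by rewrite lead_coefXn mulr1 mulfVK ?lead_coef_eq0 // subrr.
    by rewrite -{1}sRM -lead_coefE lead_coef_eq0 -size_poly_eq0 sRM size_poly_eq0 (negPf R0).
  by move: Ty; rewrite hornerD hornerN !hornerM (rootP Qy) mulr0 subr0.
exists [set u | exists R T, GX R T /\ u = (R.[x], T.[y])], y; split.
- split.
  + move=> a Fa; exists a%:P, a%:P; rewrite !hornerC; split=> //.
    by apply: GXC; apply: Gdiag.
  + move=> _ _ _ _ [R [T [GRT [-> ->]]]] [R' [T' [GRT' [-> ->]]]].
    by exists (R - R'), (T - T'); rewrite !hornerD !hornerN; split=> //; apply: GXB.
  + move=> _ _ _ _ [R [T [GRT [-> ->]]]] [R' [T' [GRT' [-> ->]]]].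
    by exists (R * R'), (T * T'); rewrite !hornerM; split=> //; apply: GXM.
  + by move=> z [R [T [GRT [R0 ->]]]]; apply: vanish GRT _.
  + move=> _ _ [R [T [GRT [-> _]]]]; apply: rpred_horner => //.
    by apply/polyOverP => i; apply: Gdom (GRT i).
- case=> a b Gab; exists a%:P, b%:P; rewrite !hornerC; split=> //; exact: GXC.
- by exists 'X, 'X; rewrite !hornerX.
Qed.

End Graph.

Lemma partial_embedding_total G0 : partial_embedding G0 ->
  exists H, [/\ partial_embedding H, G0 `<=` H & {in A, forall x, exists y, H (x, y)}].
Proof.
move=> G0P.
(* The guard lets the empty graph satisfy [Z], as it must, being the union of the empty chain. *)
pose Z H := (exists u, H u) -> partial_embedding H /\ G0 `<=` H.
have [C CZ Ctot|H [ZH Hmax]] := @Zorn_bigcup _ Z.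
  move=> [u0 [H0 CH0 H0u0]].
  have CP H u : C H -> H u -> partial_embedding H /\ G0 `<=` H.
    by move=> CH Hu; apply: (CZ _ CH); exists u.
  have join u v : (\bigcup_(X in C) X) u -> (\bigcup_(X in C) X) v ->
      exists H, [/\ C H, H u & H v].
    move=> [X CX Xu] [Y CY Yv].
    by have [XY|YX] := Ctot _ _ CX CY; [exists Y|exists X]; split=> //; [exact: XY|exact: YX].
  have [H0P G0H0] := CP _ _ CH0 H0u0.
  split; last by move=> u /G0H0 H0u; exists H0.
  split.
  - by move=> a Fa; exists H0 => //; case: H0P => /(_ a Fa).
  - move=> x y z w /join H /H[{}H [CH Hxy Hzw]]; exists H => //.
    by have [[_ + _ _ _] _] := CP _ _ CH Hxy; apply.
  - move=> x y z w /join H /H[{}H [CH Hxy Hzw]]; exists H => //.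
    by have [[_ _ + _ _] _] := CP _ _ CH Hxy; apply.
  - by move=> y [H CH Hy]; have [[_ _ _ + _] _] := CP _ _ CH Hy; apply.
  - by move=> x y [H CH Hy]; have [[_ _ _ _ +] _] := CP _ _ CH Hy; apply; apply: Hy.
have G01 : G0 (0, 0) by case: G0P => + _ _ _ _; apply; rewrite rpred0.
have maxE H' : H `<=` H' -> partial_embedding H' -> G0 `<=` H' -> H' `<=` H.
  move=> HH' H'P GH'; apply: contrapT => H'H; apply: (Hmax H').
    by rewrite properEneq; split=> //; apply/eqP => HE; apply: H'H; rewrite HE.
  by move=> _.
have [H0|/set0P[u Hu]] := eqVneq H set0.
  have := maxE G0; rewrite H0 => /(_ (@sub0set _ _) G0P (@subset_refl _ _)).
  by move=> /(_ _ G01).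
have [HP G0H] := ZH (ex_intro _ u Hu).
exists H; split=> // x Ax.
have [H' [y [H'P HH' H'xy]]] := partial_embedding_adjoin HP Ax.
by exists y; apply: (maxE H') => //; apply: subset_trans G0H HH'.
Qed.

Lemma gal_extend G : partial_embedding G ->
  exists g : gal A F, forall x y, G (x, y) -> ev g x = y.
Proof.
move=> /partial_embedding_total[H [HP GH Htot]].
have [Hdiag HB HM Hfun Hdom] := HP.
pose f x := if pselect (exists y, H (x, y)) is left e then projT1 (cid e) else x.
have fP x : x \in A -> H (x, f x).
  by move=> /Htot e; rewrite /f; case: pselect => // e'; case: cid.
have Hf x y : H (x, y) -> f x = y.
  by move=> Hxy; apply: (partial_embedding_eq HP _ Hxy); apply: fP; apply: Hdom Hxy.
have fB : {in A &, forall x y, f (x - y) = f x - f y}.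
  by move=> x y Ax Ay; apply: Hf; apply: HB; apply: fP.
have fM : {in A &, forall x y, f (x * y) = f x * f y}.
  by move=> x y Ax Ay; apply: Hf; apply: HM; apply: fP.
have f1 : f 1 = 1 by apply: Hf; apply: Hdiag; rewrite rpred1.
have fF : {in F, forall x, f x = x} by move=> x Fx; apply: Hf; apply: Hdiag.
have finj : {in A &, injective f}.
  move=> x y Ax Ay fxy; apply/eqP; rewrite -subr_eq0; apply: contraTT isT => xy0.
  have Axy : x - y \in A by rewrite rpredB.
  have [+ _] := partial_embedding_inv HP (fP _ Axy) xy0.
  by rewrite fB // fxy subrr eqxx.
have f0 : f 0 = 0 by apply: Hf; apply: Hdiag; rewrite rpred0.
have fD : {in A &, forall x y, f (x + y) = f x + f y}.
  move=> x y Ax Ay; rewrite -{1}[y]opprK fB ?rpredN //; congr (_ + _).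
  by rewrite -[in LHS](sub0r y) fB ?rpred0 // f0 sub0r opprK.
have fX x n : x \in A -> f (x ^+ n) = f x ^+ n.
  by move=> Ax; elim: n => [|n IHn]; rewrite ?expr0 // !exprS fM ?rpredX // IHn.
have fP' P x : P \is a polyOver F -> x \in A -> f P.[x] = P.[f x].
  move=> /polyOverP FP Ax; rewrite !horner_coef.
  have AF : {subset F <= A} := @sub_alg_closure _ F.
  elim: (size P) => [|n IHn]; first by rewrite !big_ord0.
  have AP i : P`_i * x ^+ i \in A.
    have APi : P`_i \in A := AF _ (FP i).
    by rewrite rpredM ?rpredX.
  rewrite !big_ord_recr /= fD ?IHn; [|exact: rpred_sum|exact: AP].
  have APn : P`_n \in A := AF _ (FP n).
  by rewrite (fM _ _ APn) ?rpredX // (fF _ (FP n)) fX.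
have Af : {in A, forall x, f x \in A}.
  move=> x Ax; have [P [FP P0 Px]] := alg_closureP _ _ Ax.
  by apply/alg_closureP; exists P; split=> //; apply/rootP; rewrite -fP' // (rootP Px).
(* f is injective and maps the finite set of roots of P into itself, so it permutes them. *)
have fsurj : {in A, forall y, exists x, x \in A /\ f x = y}.
  move=> y Ay; have [P [FP P0 Py]] := alg_closureP _ _ Ay.
  have [rs Prs] := closed_field_poly_normal P.
  have rsE z : (z \in rs) = root P z.
    by rewrite Prs rootZ ?lead_coef_eq0 // root_prod_XsubC.
  pose us := undup rs.
  have usE z : (z \in us) = root P z by rewrite mem_undup rsE.
  have usA : {subset us <= A}.
    by move=> z; rewrite usE => Pz; apply/alg_closureP; exists P.
  have fus : {subset map f us <= us}.
    move=> _ /mapP[z uz ->]; rewrite usE; apply/rootP.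
    by rewrite -fP' ?usA //; move: uz; rewrite usE => /rootP ->.
  have uf : uniq (map f us).
    by rewrite map_inj_in_uniq ?undup_uniq // => a b /usA Aa /usA; apply: finj.
  have [_ eqf] := uniq_min_size uf fus (eq_leq (esym (size_map _ _))).
  have : y \in map f us by rewrite eqf usE.
  by case/mapP => x ux ->; exists x; split=> //; apply: usA.
pose f' y := if pselect (exists x, x \in A /\ f x = y) is left e then projT1 (cid e) else y.
have f'P y : y \in A -> f' y \in A /\ f (f' y) = y.
  by move=> /fsurj e; rewrite /f'; case: pselect => // e'; case: cid.
have [g gf] := @gal_build _ A F f f' Af (fun y Ay => proj1 (f'P y Ay))
  (fun x Ax => finj _ _ (proj1 (f'P _ (Af _ Ax))) Ax (proj2 (f'P _ (Af _ Ax))))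
  (fun y Ay => proj2 (f'P y Ay)) fB fM f1 fF.
exists g => x y /GH Hxy; rewrite gf; last exact: Hdom Hxy.
exact: Hf.
Qed.

End Extension.

(** * Finite extensions embedded in the ambient field *)

Lemma embedded_simple_extension (F Omega : fieldType)
    (iota : {rmorphism F -> Omega}) (x : Omega) : algebraicOver iota x ->
  exists (E : fieldExtType F) (j : {rmorphism E -> Omega}) (r : E),
    [/\ forall a : F, j a%:A = iota a, j r = x
      & forall e, exists f : {poly F}, j e = (map_poly iota f).[x]].
Proof.
move=> [f0 f00 f0x].
pose S n := `[< exists f, [/\ f != 0, root (map_poly iota f) x & size f = n] >].
have exS : exists n, S n by exists (size f0); apply/asboolP; exists f0.
case: (ex_minnP exS) => n /asboolP[f [f_neq0 fx sf]] minf.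
have irr_f : irreducible_poly f.
  apply/(subfx_irreducibleP fx f_neq0) => q qx q0; rewrite sf; apply: minf.
  by apply/asboolP; exists q.
pose E := SubFieldExtType fx irr_f.
exists E, (@subfx_inj _ _ iota x f : {rmorphism E -> Omega}), (@subfx_root _ _ iota x f).
split; [exact: subfx_inj_base | exact: subfx_inj_root | move=> e].
by have [q ->] := subfxE e; exists q; apply: subfx_inj_eval.
Qed.

(* The last clause says that E is generated by F and rs. *)
Lemma embedded_extension (F Omega : fieldType)
    (iota : {rmorphism F -> Omega}) (xs : seq Omega) :
    {in xs, forall x, algebraicOver iota x} ->
  exists (E : fieldExtType F) (j : {rmorphism E -> Omega}) (rs : seq E),
    [/\ forall a : F, j a%:A = iota a, map j rs = xs
      & forall M : subfield Omega, (forall a, iota a \in M) ->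
          {subset xs <= M} -> forall e, j e \in M].
Proof.
elim: xs F iota => [|x xs IHxs] F iota alg_xs.
  exists F^o, (iota : {rmorphism F^o -> Omega}), [::].
  by split=> // a; rewrite /= /GRing.scale /= mulr1.
have [E1 [j1 [r [j1A j1r j1P]]]] := embedded_simple_extension (alg_xs x (mem_head _ _)).
have alg1 : {in xs, forall y, algebraicOver j1 y}.
  move=> y xsy; have [f f0 fy] : algebraicOver iota y.
    by apply: alg_xs; rewrite inE xsy orbT.
  exists (map_poly (in_alg E1) f); first by rewrite map_poly_eq0.
  by rewrite -map_poly_comp (eq_map_poly (g := iota)) // => a; exact: j1A.
have [E [j [rs [jA jrs jP]]]] := IHxs E1 j1 alg1.
exists (baseFieldType E), (j : {rmorphism baseFieldType E -> Omega}), (r%:A :: rs).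
split=> [a||M FM xsM e].
- by rewrite baseField_scaleE jA j1A.
- by rewrite /= jrs jA j1r.
- apply: jP => [u|y xsy]; last by apply: xsM; rewrite inE xsy orbT.
  have [f ->] := j1P u; apply: rpred_horner; last by apply: xsM; rewrite mem_head.
  by apply/polyOverP => i; rewrite coef_map; exact: FM.
Qed.

Section ImageSubfield.
Variables (F Omega : fieldType) (E : fieldExtType F) (j : {rmorphism E -> Omega}).

Lemma image_vspace_closed (U : {subfield E}) :
  divring_closed (mem [set j e | e in [set` U]]).
Proof.
split.
- by apply/mem_set; exists 1; rewrite ?rmorph1 //= rpred1.
- move=> _ _ /set_mem[a Ua <-] /set_mem[b Ub <-].
  by apply/mem_set; exists (a - b); rewrite ?rmorphB //= rpredB.
- move=> _ _ /set_mem[a Ua <-] /set_mem[b Ub <-].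
  by apply/mem_set; exists (a / b); rewrite ?fmorph_div //= rpred_div.
Qed.

Definition image_vspace (U : {subfield E}) : subfield Omega := Subfield (image_vspace_closed U).

Lemma image_vspaceP (U : {subfield E}) x :
  reflect (exists2 e, e \in U & j e = x) (x \in image_vspace U).
Proof. by apply: (iffP idP) => [/set_mem|H]; [|apply/mem_set]. Qed.

End ImageSubfield.

(** The image of the field generated by rs contains F and xs, hence the image of E; injectivity of j
    concludes. *)
Lemma embedded_extension_seq (F Omega : fieldType)
    (iota : {rmorphism F -> Omega}) (xs : seq Omega) :
    {in xs, forall x, algebraicOver iota x} ->
  exists (E : fieldExtType F) (j : {rmorphism E -> Omega}) (rs : seq E),
    [/\ forall a : F, j a%:A = iota a, map j rs = xs & <<1 & rs>>%VS = {:E}%VS].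
Proof.
move=> /embedded_extension[E [j [rs [jA jrs jP]]]]; exists E, j, rs; split=> //.
apply/vspaceP => e; rewrite memvf.
have /image_vspaceP[e' + /(fmorph_inj j) <-] // : j e \in image_vspace j <<1 & rs>>%AS.
apply: jP => [a|x]; first by apply/image_vspaceP; exists a%:A; rewrite // rpredZ ?rpred1.
rewrite -jrs => /mapP[r rsr ->]; apply/image_vspaceP; exists r => //.
exact: seqv_sub_adjoin.
Qed.

(** * Separable elements of the ambient field *)

Section Separable.
Variable Omega : fieldType.
Implicit Types (K M : subfield Omega) (x y : Omega) (P Q : {poly Omega}).

Definition sepover K x :=
  exists P, [/\ P \is a polyOver K, separable_poly P & root P x].

Lemma sepover_alg K x : sepover K x -> x \in alg_closure K.
Proof.
by move=> [P [KP sP Px]]; apply/alg_closureP; exists P; rewrite separable_poly_neq0.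
Qed.

Lemma sepoverS K M x : {subset K <= M} -> sepover K x -> sepover M x.
Proof.
by move=> KM [P [KP sP Px]]; exists P; split=> //; apply: polyOver_sub KM KP.
Qed.

Lemma base_sepover K x : x \in K -> sepover K x.
Proof.
move=> Kx; exists ('X - x%:P); rewrite polyOverXsubC Kx root_XsubC eqxx; split=> //.
by have := separable_prod_XsubC [:: x]; rewrite big_seq1 => ->.
Qed.

Section Embedded.
Variables (K : subfield Omega) (E : fieldExtType K) (j : {rmorphism E -> Omega}).
Hypothesis jA : forall a : K, j a%:A = val a.

Lemma polyOver1_map (p : {poly E}) : p \is a polyOver 1%VS ->
  map_poly j p \is a polyOver K.
Proof.
move=> /polyOverP p1; apply/polyOverP => i; rewrite coef_map.
by have /vlineP[a ->] := p1 i; rewrite /= jA elt_valP.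
Qed.

Lemma polyOver_lift1 P : P \is a polyOver K ->
  exists2 p : {poly E}, p \is a polyOver 1%VS & map_poly j p = P.
Proof.
move=> /polyOver_lift[f ->]; exists (map_poly (in_alg E) f).
  by apply/polyOverP => i; rewrite coef_map rpredZ ?rpred1.
by rewrite -map_poly_comp; apply: eq_map_poly => a; apply: jA.
Qed.

Lemma sepover_embedded e : sepover K (j e) <-> separable_element 1%AS e.
Proof.
split=> [[P [/polyOver_lift1[p p1 <-]]]|/separable_elementP[p [p1 pe sp]]].
  rewrite separable_map fmorph_root => sp pe.
  by apply/separable_elementP; exists p.
by exists (map_poly j p); rewrite polyOver1_map // separable_map fmorph_root.
Qed.

End Embedded.

Lemma sepover_minpoly K x : sepover K x ->
  exists P, [/\ P \is a polyOver K, separable_poly P, root P x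
              & forall Q, Q \is a polyOver K -> root Q x -> P %| Q].
Proof.
move=> sx; have [|E [j [rs [jA jrs _]]]] := @embedded_extension_seq K Omega val [:: x].
  by move=> _ /[1!inE] /eqP ->; apply/asboolP/sepover_alg.
case: rs jrs => [//|e [|//]] [je].
exists (map_poly j (minPoly 1%AS e)); split.
- exact/polyOver1_map/minPolyOver.
- by rewrite separable_map; apply/(sepover_embedded jA); rewrite je.
- by rewrite -je fmorph_root root_minPoly.
- move=> Q /(polyOver_lift1 jA)[q q1 <-]; rewrite -je fmorph_root dvdp_map.
  exact: minPoly_dvdp.
Qed.

End Separable.

(** * Conjugate roots and Galois closures in the ambient field *)

Section GaloisEmbedding.
Variables (Omega : closedFieldType) (F K : subfield Omega).
Local Notation A := (alg_closure F).
Hypotheses (FK : {subset F <= K}) (KA : {subset K <= A}).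
Implicit Types (g : gal A F) (x y : Omega).

Lemma sepover_in x : sepover K x -> x \in A.
Proof. by move/sepover_alg; apply: alg_closure_trans. Qed.

(** The pairs (Q(x), Q(y)) form a partial embedding: since P divides every Q that vanishes at x,
    they are single-valued. *)
Lemma conjugate_roots x y P : P \is a polyOver K -> P != 0 -> root P x -> root P y ->
    (forall Q, Q \is a polyOver K -> root Q x -> P %| Q) ->
  exists g, {in K, ev g =1 id} /\ ev g x = y.
Proof.
move=> KP P0 Px Py minP.
pose G := [set u | exists Q, Q \is a polyOver K /\ u = (Q.[x], Q.[y])].
have Ax : x \in A.
  by apply: (alg_closure_trans KA); apply/alg_closureP; exists P.
have [|g gG] := @gal_extend _ F G.
  split.
  - move=> a Fa; exists a%:P; rewrite !hornerC; split=> //.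
    by rewrite polyOverC FK.
  - move=> _ _ _ _ [Q [KQ [-> ->]]] [R [KR [-> ->]]]; exists (Q - R).
    by rewrite !hornerE rpredB.
  - move=> _ _ _ _ [Q [KQ [-> ->]]] [R [KR [-> ->]]]; exists (Q * R).
    by rewrite !hornerE rpredM.
  - move=> z [Q [KQ [Q0 ->]]]; have /dvdpP[R ->] : P %| Q by apply: minP => //; apply/rootP.
    by rewrite hornerM (rootP Py) mulr0.
  - move=> _ _ [Q [KQ [-> _]]]; apply: rpred_horner => //.
    exact: polyOver_sub KA KQ.
exists g; split=> [a Ka|]; apply: gG; last first.
  by exists 'X; rewrite !hornerX polyOverX.
by exists a%:P; rewrite !hornerC polyOverC.
Qed.

(** E is the splitting field of the product of the minimal polynomials of xs. The last clause
    carries automorphism-invariant properties from xs to generators of E. *)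
Lemma galois_embedding (xs : seq Omega) : (forall x, x \in xs -> sepover K x) ->
  exists (E : splittingFieldType K) (j : {rmorphism E -> Omega}) (rs : seq E),
    [/\ forall a : K, j a%:A = val a, galois 1%AS {:E}%AS, <<1 & rs>>%VS = {:E}%VS,
        {subset xs <= map j rs}
      & forall r, r \in rs -> exists x g,
          [/\ x \in xs, {in K, ev g =1 id} & j r = ev g x]].
Proof.
move=> sep_xs.
pose minp x P := [/\ P \is a polyOver K, separable_poly P, root P x
              & forall Q, Q \is a polyOver K -> root Q x -> P %| Q].
have /choice[m mP] : forall x, exists P, x \in xs -> minp x P.
  move=> x; have [/sep_xs/sepover_minpoly[P ?]|_] := boolP (x \in xs); last by exists 0.
  by exists P.
have /choice[s sP] : forall x, exists s, x \in xs -> m x %= \prod_(y <- s) ('X - y%:P).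
  move=> x; have [xsx|_] := boolP (x \in xs); last by exists [::].
  have [_ /separable_poly_neq0 m0 _ _] := mP x xsx.
  have [s mE] := closed_field_poly_normal (m x); exists s => _.
  by rewrite {1}mE eqp_scale ?lead_coef_eq0.
pose ys := flatten (map s xs).
have ysP y : y \in ys -> exists2 x, x \in xs & root (m x) y.
  move=> /flatten_mapP[x xsx sxy]; exists x => //.
  by rewrite (eqp_root (sP x xsx)) root_prod_XsubC.
have yssep y : y \in ys -> sepover K y.
  by move=> /ysP[x /mP[Km sm _ _] my]; exists (m x).
have [|E [j [rs [jA jrs genE]]]] := @embedded_extension_seq K Omega val ys.
  by move=> y /yssep/sepover_alg/asboolP.
have KP : \prod_(x <- xs) m x \is a polyOver K.
  by rewrite big_seq; apply: rpred_prod => x /mP[].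
have [p p1 jp] := polyOver_lift1 jA KP.
have splitE : SplittingField.axiom E.
  exists p => //; exists rs => //; rewrite -(eqp_map j) jp rmorph_prod /=.
  rewrite (eq_bigr (fun r => 'X - (j r)%:P)); last by move=> r _; rewrite map_polyXsubC.
  rewrite -(big_map j predT (fun y => 'X - y%:P)) jrs /ys.
  (* The induction needs sublists of xs, because [sP] says nothing about elements outside xs. *)
  have {jp jrs}: {subset xs <= xs} by [].
  elim: {1 3 4}xs => [|x t IHt] sub; first by rewrite !big_nil eqpxx.
  rewrite big_cons /= big_cat /=; apply: eqp_trans (eqp_mull _ _).
    by apply: eqp_mulr; apply: sP; apply: sub; rewrite mem_head.
  by apply: IHt => y ty; apply: sub; rewrite inE ty orbT.
pose E' : splittingFieldType K :=
  HB.pack (FieldExt.sort E) (FieldExt_isSplittingField.Build K E splitE).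
exists E', (j : {rmorphism E' -> Omega}), rs; split => //.
- have sep1 : separable 1%AS {:E'}%AS.
    have genE' : <<1 & rs : seq E'>>%VS = {:E'}%VS by [].
    suff : separable 1%AS <<1 & rs : seq E'>>%AS by rewrite [X in separable _ X]genE'.
    apply: separable_Fadjoin_seq; apply/allP => r rsr.
    by apply/(sepover_embedded jA)/yssep; rewrite -jrs map_f.
  by rewrite /galois sub1v sep1 normalFieldf.
- move=> x xsx; rewrite jrs; apply/flatten_mapP; exists x => //.
  rewrite -root_prod_XsubC -(eqp_root (sP x xsx)).
  by have [] := mP x xsx.
- move=> r rsr; have /ysP[x xsx mr] : j r \in ys by rewrite -jrs map_f.
  have [Km sm mx minm] := mP x xsx.
  have [g [gK gx]] := conjugate_roots Km (separable_poly_neq0 sm) mx mr minm.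
  by exists x, g.
Qed.
End GaloisEmbedding.

(** * Restricting and lifting automorphisms *)

Section Restriction.
Variables (Omega : closedFieldType) (F K : subfield Omega).
Local Notation A := (alg_closure F).
Hypotheses (FK : {subset F <= K}) (KA : {subset K <= A}).
Variables (E : splittingFieldType K) (j : {rmorphism E -> Omega}).
Hypotheses (jA : forall a : K, j a%:A = val a) (galE : galois 1%AS {:E}%AS).
Implicit Types (g : gal A F) (s : gal_of {:E}%AS) (e : E).

Lemma embedded_sepover e : sepover K (j e).
Proof.
apply/(sepover_embedded jA); case/and3P: galE => _ /separableP sepE _.
by apply: sepE; rewrite memvf.
Qed.

Lemma embedded_in e : j e \in A.
Proof. exact: sepover_in KA _ (embedded_sepover e). Qed.

(** Normality: g sends j e to another root of the minimal polynomial of e, and all these roots come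
    from E. *)
Lemma gal_restrict g : {in K, ev g =1 id} ->
  exists s, forall e, ev g (j e) = j (s e).
Proof.
move=> gK.
have /choice[f jf] : forall e, exists e', j e' = ev g (j e).
  move=> e; have [rs minE] := splitting_field_normal 1%AS e.
  pose P := map_poly j (minPoly 1%AS e).
  have KP : P \is a polyOver K by apply/(polyOver1_map jA)/minPolyOver.
  have : root P (ev g (j e)).
    apply: ev_root; first exact: embedded_in.
    - exact: polyOver_sub KA KP.
    - by move=> i; apply: gK; apply/polyOverP.
    - by rewrite fmorph_root root_minPoly.
  rewrite /P (eqP minE) rmorph_prod /=.
  rewrite (eq_bigr (fun r => 'X - (j r)%:P)); last by move=> r _; rewrite map_polyXsubC.
  rewrite -(big_map j predT (fun y => 'X - y%:P)) root_prod_XsubC.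
  by move=> /mapP[r _ ->]; exists r.
have fB : zmod_morphism f.
  by move=> x y; apply: (fmorph_inj j); rewrite rmorphB !jf rmorphB evB ?embedded_in.
have fM : monoid_morphism f.
  split=> [|x y]; apply: (fmorph_inj j); first by rewrite jf rmorph1 ev_1.
  by rewrite rmorphM !jf rmorphM ev_mul ?embedded_in.
have fZ : scalable f.
  move=> a x; apply: (fmorph_inj j).
  rewrite jf -mulr_algl rmorphM jA ev_mul ?embedded_in //; last by apply/KA/elt_valP.
  by rewrite gK ?elt_valP // -[a *: f x]mulr_algl rmorphM jA jf.
pose fl : {linear E -> E} := HB.pack f (GRing.isZmodMorphism.Build _ _ f fB)
  (GRing.isScalable.Build _ _ _ _ f fZ).
have khf : kHom 1 {:E} (linfun fl).
  apply/kHom_monoid_morphism; split=> [|x y]; rewrite !lfunE /=; first by case: fM.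
  by case: fM.
have [s _ sf] := kAut_to_gal (etrans (kAutfE 1%AS (linfun fl)) khf).
by exists s => e; rewrite -jf -sf ?memvf // lfunE.
Qed.

Lemma gal_lift s : exists g, {in K, ev g =1 id} /\ forall e, ev g (j e) = j (s e).
Proof.
have s1 (a : K) : s a%:A = a%:A by rewrite linearZ /= rmorph1.
pose G := [set u | exists e, u = (j e, j (s e))].
have GK a : a \in K -> G (a, a).
  by move=> Ka; exists (SubfieldElt Ka)%:A; rewrite s1 jA.
have [|g gG] := @gal_extend _ F G.
  split.
  - by move=> a /FK; apply: GK.
  - by move=> _ _ _ _ [e [-> ->]] [e' [-> ->]]; exists (e - e'); rewrite !rmorphB.
  - by move=> _ _ _ _ [e [-> ->]] [e' [-> ->]]; exists (e * e'); rewrite !rmorphM.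
  - move=> y [e [e0 ->]]; have /eqP := esym e0; rewrite fmorph_eq0 => /eqP ->.
    by rewrite !rmorph0.
  - by move=> _ _ [e [-> _]]; apply: embedded_in.
by exists g; split=> [a Ka|e]; apply: gG; [exact: GK | exists e].
Qed.

Lemma ev_restrictX g s n e : (forall e, ev g (j e) = j (s e)) ->
  ev (g ^+ n)%g (j e) = j ((s ^+ n)%g e).
Proof.
move=> gs; elim: n => [|n IHn] in e *; first by rewrite ev1 gal_id.
by rewrite expgSr evM gs IHn expgS galM ?memvf.
Qed.

End Restriction.

(** * Pointwise description of K(p) *)

Section MaxPExtension.
Variables (Omega : closedFieldType) (F K : subfield Omega) (p : nat).
Local Notation A := (alg_closure F).
Hypotheses (FK : {subset F <= K}) (KA : {subset K <= A}) (p_prime : prime p).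
Implicit Types (g h : gal A F) (x y : Omega) (M : subfield Omega).

Definition p_torsion x :=
  forall g, {in K, ev g =1 id} -> exists a, ev (g ^+ (p ^ a))%g x = x.

Lemma ev_fix_seq g (xs : seq Omega) :
    (forall x, x \in xs -> exists a, ev (g ^+ (p ^ a))%g x = x) ->
  exists a, {in xs, ev (g ^+ (p ^ a))%g =1 id}.
Proof.
elim: xs => [|x xs IHxs] gxs; first by exists 0%N.
have [|a ga] := IHxs; first by move=> y xsy; apply: gxs; rewrite inE xsy orbT.
have [b gb] := gxs x (mem_head _ _).
exists (maxn a b) => y /[1!inE] /predU1P[->|xsy].
  exact: ev_fix_leq (leq_maxr _ _) gb.
exact: ev_fix_leq (leq_maxl _ _) (ga y xsy).
Qed.

Lemma p_torsion_ev h x : {in K, ev h =1 id} -> p_torsion x -> p_torsion (ev h x).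
Proof.
move=> hK px g gK; have [|a ga] := px (h^-1 * g * h)%g; last first.
  by exists a; apply: ev_conj_fix.
by move=> y Ky; rewrite !evM hK // gK // ev_fixV // hK.
Qed.

(** The order p^k of the Galois group kills the restriction of every automorphism, so one exponent
    serves all of M. *)
Lemma galois_p_extension_good M x : galois_p_extension p K M -> x \in M ->
  sepover K x /\ p_torsion x.
Proof.
move=> [E [j [jA galE [k dimE] jM]]] Mx.
have [e _ <-] : range j x by rewrite jM.
split; first exact: embedded_sepover.
move=> g gK; have [s gs] := gal_restrict KA jA galE gK; exists k.
rewrite (ev_restrictX _ _ gs) -dimE.
have : s \in 'Gal({:E} / 1)%g by rewrite gal_kHom ?sub1v // k1HomE ahomWin.
have := galois_dim galE; rewrite dimv1 divn1 => -> sG.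
by rewrite expg_cardG ?gal_id.
Qed.

(** In a Galois closure of xs the generators are conjugates of xs, hence torsion too. If a prime q
    divides the group order, Cauchy gives s of order q; a p-power of a lift of s fixes all
    generators, so q divides a power of p. *)
Lemma good_galois_p_extension (xs : seq Omega) :
    (forall x, x \in xs -> sepover K x /\ p_torsion x) ->
  exists2 M, galois_p_extension p K M & {subset xs <= M}.
Proof.
move=> xsP; have [|E [j [rs [jA galE genE xsj rsP]]]] := @galois_embedding _ _ _ FK KA xs.
  by move=> x /xsP[].
exists (image_vspace j {:E}%AS); last first.
  by move=> x /xsj/mapP[r _ ->]; apply/image_vspaceP; exists r; rewrite ?memvf.
exists E, j; split=> //; last first.
  apply/seteqP; split=> [x [e _ <-]|x /image_vspaceP[e _ <-]]; last by exists e.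
  by apply/image_vspaceP; exists e; rewrite ?memvf.
have := galois_dim galE; rewrite dimv1 divn1 => ->.
suff /p_natP[k ->] : pgroup p 'Gal({:E} / 1)%g by exists k.
apply/pgroupP => q q_prime /Cauchy-/(_ q_prime)[s sG os].
have [g [gK gs]] := gal_lift FK KA jA galE s.
have [|a ga] := @ev_fix_seq g (map j rs).
  move=> _ /mapP[r rsr ->]; have [x [h [xsx hK ->]]] := rsP _ rsr.
  by apply: p_torsion_ev => //; have [] := xsP x xsx.
have sa1 : (s ^+ (p ^ a) = 1)%g.
  apply/eqP/gal_eqP => e _; rewrite gal_id.
  suff : (<<1 & rs>> <= fixedField (finset.set1 (s ^+ (p ^ a))%g))%VS.
    move=> /subvP/(_ e); rewrite genE memvf => /(_ isT)/mem_fixedFieldP[_].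
    by apply; apply/finset.set1P.
  apply/Fadjoin_seqP; split; first exact: sub1v.
  move=> r rsr; apply/fixedFieldP; first exact: memvf.
  move=> _ /finset.set1P ->; apply: (fmorph_inj j); rewrite -(ev_restrictX _ _ gs).
  by rewrite ga ?map_f.
have : (q %| p ^ a)%N by rewrite -os order_dvdn sa1.
by rewrite Euclid_dvdX // => /andP[]; rewrite dvdn_prime2 // => /eqP ->; rewrite inE.
Qed.

(** Two good elements lie in a common finite Galois p-extension, and everything in it is good. *)
Lemma good_closed : divring_closed
  ([pred x | `[< sepover K x /\ p_torsion x >]] : pred Omega).
Proof.
have good2 x y : sepover K x /\ p_torsion x -> sepover K y /\ p_torsion y ->
    exists M, [/\ galois_p_extension p K M, x \in M & y \in M].
  move=> gx gy; have [|M MP sub] := @good_galois_p_extension [:: x; y].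
    by move=> z; rewrite !inE => /orP[]/eqP ->.
  by exists M; split=> //; apply: sub; rewrite !inE eqxx ?orbT.
split.
- apply/asboolP; split; first by apply: base_sepover; rewrite rpred1.
  by move=> g gK; exists 0%N; rewrite expg1 ev_1.
- move=> x y /asboolP gx /asboolP gy; have [M [MP Mx My]] := good2 x y gx gy.
  by apply/asboolP; apply: galois_p_extension_good MP _; rewrite rpredB.
- move=> x y /asboolP gx /asboolP gy; have [M [MP Mx My]] := good2 x y gx gy.
  by apply/asboolP; apply: galois_p_extension_good MP _; rewrite rpred_div.
Qed.

Lemma max_p_extensionP x :
  x \in max_p_extension p K <-> sepover K x /\ p_torsion x.
Proof.
split=> [|gx].
  move=> /(@generated_min _ _ (Subfield good_closed)) H; apply/asboolP; apply: H.
  move=> y [Ky|[M MP My]]; apply/asboolP; last exact: galois_p_extension_good MP My.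
  split; first exact: base_sepover.
  by move=> g gK; exists 0%N; rewrite expg1 gK.
have [|M MP sub] := @good_galois_p_extension [:: x].
  by move=> y /[1!inE] /eqP ->.
by apply: generated_incl; right; exists M => //; apply: sub; rewrite mem_head.
Qed.

End MaxPExtension.

(** * The fields L = F(mu_p), L(p) and F(p) *)

Section GaloisExtension.
Variables (Omega : closedFieldType) (F E : subfield Omega).
Local Notation A := (alg_closure F).
Hypotheses (FE : {subset F <= E}) (EA : {subset E <= A}).

Lemma gal_extend_alg (g : gal E F) : exists h : gal A F, {in E, ev h =1 ev g}.
Proof.
have [|h hG] := @gal_extend _ F [set u | exists2 x, x \in E & u = (x, ev g x)].
  split.
  - by move=> a Fa; exists a; rewrite ?ev_fix // FE.
  - by move=> _ _ _ _ [x Ex [-> ->]] [y Ey [-> ->]]; exists (x - y); rewrite ?rpredB ?evB.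
  - by move=> _ _ _ _ [x Ex [-> ->]] [y Ey [-> ->]]; exists (x * y); rewrite ?rpredM ?ev_mul.
  - by move=> y [x Ex [<- ->]]; rewrite ev_0.
  - by move=> _ _ [x Ex [-> _]]; apply: EA.
by exists h => x Ex; apply: hG; exists x.
Qed.

(** Stability is asked of all automorphisms so that it covers the inverse of h. *)
Lemma gal_restrict_stable (h : gal A F) :
    (forall (h : gal A F) x, x \in E -> ev h x \in E) ->
  exists g : gal E F, {in E, ev g =1 ev h}.
Proof.
move=> stabE; apply: (@gal_build _ E F (ev h) (ev h^-1%g)).
- by move=> x; apply: stabE.
- by move=> x; apply: stabE.
- by move=> x _; apply: evK.
- by move=> x _; apply: evVK.
- by move=> x y Ex Ey; apply: evB; apply: EA.
- by move=> x y Ex Ey; apply: ev_mul; apply: EA.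
- exact: ev_1.
- by move=> x Fx; apply: ev_fix.
Qed.

Lemma ev_agreeX (g : gal E F) (h : gal A F) n : {in E, ev h =1 ev g} ->
  {in E, ev (h ^+ n)%g =1 ev (g ^+ n)%g}.
Proof.
move=> hg x Ex; elim: n => [|n IHn]; first by rewrite !ev1.
by rewrite !expgS !evM IHn hg // ev_in.
Qed.

End GaloisExtension.

Section Setup.
Variables (Omega : closedFieldType) (F : subfield Omega) (p : nat).
Hypotheses (p_prime : prime p) (p_neq0 : p%:R != 0 :> Omega).
Local Notation A := (alg_closure F).
Local Notation L := (adjoin_roots p F).
Local Notation Lp := (max_p_extension p L).
Local Notation Fp := (max_p_extension p F).

Lemma prim_root_exists n : n%:R != 0 :> Omega ->
  exists z : Omega, n.-primitive_root z.
Proof.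
move=> n0; have n_gt0 : (0 < n)%N by case: n n0; rewrite ?eqxx.
have [rs Ers] := closed_field_poly_normal ('X^n - 1 : {poly Omega}).
rewrite lead_coefXnsubC // scale1r in Ers.
have /hasP[z _ zP] : has n.-primitive_root rs.
  apply: has_prim_root => //.
  - by apply/allP => z; rewrite unity_rootE -root_prod_XsubC -Ers rootE !hornerE subr_eq0.
  - by rewrite -separable_prod_XsubC -Ers separable_Xn_sub_1.
  - by have := size_prod_XsubC rs id; rewrite -Ers size_Xn_sub_1 // => -[->].
by exists z.
Qed.

Lemma natrX_neq0 m : (p ^ m)%:R != 0 :> Omega.
Proof. by rewrite natrX expf_neq0. Qed.

Lemma adjoin_roots_base : {subset F <= L}.
Proof. by move=> x Fx; apply: generated_incl; left. Qed.

Lemma adjoin_roots_unity x : x ^+ p = 1 -> x \in L.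
Proof. by move=> xp; apply: generated_incl; right. Qed.

Lemma unity_root_sepover x m : x ^+ (p ^ m) = 1 -> sepover F x.
Proof.
move=> xp; exists ('X^(p ^ m) - 1).
rewrite separable_Xn_sub_1 ?natrX_neq0 // rpredB ?rpredX ?polyOverX ?rpred1 //.
by rewrite rootE !hornerE xp subrr.
Qed.

Lemma adjoin_roots_alg : {subset L <= A}.
Proof.
apply: generated_min => x [Fx|xp]; first exact: sub_alg_closure.
by apply: sepover_alg; apply: (@unity_root_sepover x 1); rewrite expn1.
Qed.

(** The conjunct [x \in E] excludes the points outside E, all of which [ev g] fixes by
    convention. *)
Lemma fix_closed (E K : subfield Omega) (g : gal E K) :
  divring_closed ([pred x | (x \in E) && (ev g x == x)] : pred Omega).
Proof.
split.
- by rewrite inE rpred1 ev_1 eqxx.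
- move=> x y; rewrite !inE => /andP[Ex /eqP gx] /andP[Ey /eqP gy].
  by rewrite rpredB // evB // gx gy eqxx.
- move=> x y; rewrite !inE => /andP[Ex /eqP gx] /andP[Ey /eqP gy].
  by rewrite rpred_div // ev_mul ?rpredV // ev_V gx gy eqxx.
Qed.

Lemma fix_adjoin_roots (E : subfield Omega) (g : gal E F) : {subset L <= E} ->
  (forall x, x ^+ p = 1 -> ev g x = x) -> {in L, ev g =1 id}.
Proof.
move=> LE gp x Lx; apply/eqP.
have /andP[] // : (x \in E) && (ev g x == x).
move: x Lx; apply: (@generated_min _ _ (Subfield (fix_closed g))) => x [Fx|xp].
  by rewrite /= inE ev_fix // eqxx andbT LE // adjoin_roots_base.
by rewrite /= inE gp // eqxx andbT LE // adjoin_roots_unity.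
Qed.

(** Gal(A/L) is normal, because automorphisms permute the p-th roots of unity. *)
Lemma fix_adjoin_roots_conj (g h : gal A F) : {in L, ev g =1 id} ->
  {in L, ev (h^-1 * g * h)%g =1 id}.
Proof.
move=> gL; apply: fix_adjoin_roots; first exact: adjoin_roots_alg.
move=> x xp; rewrite !evM gL ?evK //; apply: adjoin_roots_unity.
by rewrite -ev_exp ?xp ?ev_1 // adjoin_roots_alg // adjoin_roots_unity.
Qed.

(** L is F(z) for a primitive p-th root of unity z, separable over F, so transitivity of
    separability applies in a finite extension containing z and x. *)
Lemma sepover_trans x : sepover L x -> sepover F x.
Proof.
move=> Lx; have [z zP] := prim_root_exists p_neq0.
have [|E [j [rs [jA jrs _]]]] := @embedded_extension_seq F Omega val [:: z; x].
  move=> y; rewrite !inE => /orP[]/eqP ->; apply/asboolP.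
    by apply: sepover_alg; apply: (@unity_root_sepover z 1); rewrite expn1 prim_expr_order.
  exact: sepover_in adjoin_roots_alg _ Lx.
case: rs jrs => [//|r [//|e [|//]]] [jr je].
have Lj : {subset L <= image_vspace j <<1; r>>%AS}.
  apply: generated_min => y [Fy|yp]; apply/image_vspaceP.
    by exists (SubfieldElt Fy)%:A; rewrite ?jA // rpredZ ?rpred1.
  have [i ->] := prim_rootP zP yp; exists (r ^+ i); last by rewrite rmorphXn /= jr.
  by rewrite rpredX // memv_adjoin.
rewrite -je; apply/(sepover_embedded jA).
apply: (adjoin_separable (y := r)).
  by apply/(sepover_embedded jA); rewrite jr; apply: (@unity_root_sepover z 1);
     rewrite expn1 prim_expr_order.
have [P [/polyOverP LP sP Px]] := Lx.
have /choice[c cP] : forall i, exists c, c \in <<1; r>>%AS /\ j c = P`_i.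
  by move=> i; have /image_vspaceP[c ? ?] := Lj _ (LP i); exists c.
pose q := \poly_(i < size P) c i.
have jq : map_poly j q = P.
  apply/polyP => i; rewrite coef_map coef_poly; case: ltnP => [_|sPi].
    by have [] := cP i.
  by rewrite raddf0 nth_default.
apply/separable_elementP; exists q; split.
- by apply/polyOver_poly => i _; have [] := cP i.
- by rewrite -(fmorph_root j) jq je.
- by rewrite -(separable_map j) jq.
Qed.

Lemma max_p_adjoinP x : x \in Lp <-> sepover L x /\
  forall g : gal A F, {in L, ev g =1 id} -> exists a, ev (g ^+ (p ^ a))%g x = x.
Proof. exact: max_p_extensionP adjoin_roots_base adjoin_roots_alg p_prime x. Qed.

Lemma max_p_baseP x : x \in Fp <-> sepover F x /\
  forall g : gal A F, exists a, ev (g ^+ (p ^ a))%g x = x.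
Proof.
have := @max_p_extensionP _ F F p (fun _ => id) (@sub_alg_closure _ F) p_prime x.
move=> [H1 H2]; split=> [/H1[sx xt]|[sx xt]].
  by split=> // g; apply: xt => y Fy; rewrite ev_fix.
by apply: H2; split=> // g _.
Qed.

Lemma max_p_base_sub : {subset Fp <= Lp}.
Proof.
move=> x /max_p_baseP[sx xt]; apply/max_p_adjoinP; split=> [|g _ //].
exact: sepoverS adjoin_roots_base sx.
Qed.

Lemma max_p_alg : {subset Lp <= A}.
Proof. by move=> x /max_p_adjoinP[/sepover_trans/sepover_alg]. Qed.

Lemma max_p_sub : {subset L <= Lp}.
Proof. by move=> x Lx; apply: generated_incl; left. Qed.

Lemma base_max_p_sub : {subset F <= Fp}.
Proof. by move=> x Lx; apply: generated_incl; left. Qed.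

Lemma max_p_base_alg : {subset Fp <= A}.
Proof. by move=> x /max_p_base_sub/max_p_alg. Qed.

Lemma sepover_ev (g : gal A F) x : sepover F x -> sepover F (ev g x).
Proof.
move=> sx; have [P [FP sP Px]] := sx; exists P; split=> //.
apply: ev_root => //; first exact: sepover_alg.
  exact: polyOver_sub (@sub_alg_closure _ F) FP.
by move=> i; apply: ev_fix; apply/polyOverP.
Qed.

Lemma max_p_stable (h : gal A F) x : x \in Lp -> ev h x \in Lp.
Proof.
move=> /max_p_adjoinP[/sepover_trans sx xt]; apply/max_p_adjoinP; split.
  by apply: sepoverS (sepover_ev h sx); apply: adjoin_roots_base.
move=> g gL; have [a ga] := xt _ (@fix_adjoin_roots_conj g h gL).
by exists a; apply: ev_conj_fix.
Qed.

Lemma max_p_base_stable (h : gal A F) x : x \in Fp -> ev h x \in Fp.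
Proof.
move=> /max_p_baseP[sx xt]; apply/max_p_baseP; split; first exact: sepover_ev.
by move=> g; have [a ga] := xt (h^-1 * g * h)%g; exists a; apply: ev_conj_fix.
Qed.

(** If h fixes L and y^p, it multiplies y by a p-th root of unity, which lies in L and is fixed by
    h; hence h^p fixes y. For separability, substitute X^p in the minimal polynomial of y^p. *)
Lemma max_p_root_closed y : y ^+ p \in Lp -> y \in Lp.
Proof.
have [-> _|y0] := eqVneq y 0; first by rewrite rpred0.
move=> /max_p_adjoinP[sx xt].
have sy : sepover L y.
  have [P [KP sP Px minP]] := sepover_minpoly sx.
  (* If X divided P, the cofactor would still vanish at the non-zero y^p, against minimality. A
     non-zero constant term makes P(X^p) coprime to the factor p X^(p-1) of its derivative. *)
  have P0 : P`_0 != 0.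
    apply/eqP => P00; have rP0 : root P 0 by rewrite rootE horner_coef0 P00.
    have /factor_theorem[Q QE] := rP0; rewrite subr0 in QE.
    have LQ : Q \is a polyOver L.
      apply/polyOverP => i; have /polyOverP/(_ i.+1) := KP.
      by rewrite QE coefMX.
    have Qx : root Q (y ^+ p).
      by move: Px; rewrite QE rootM rootX expf_eq0 (negPf y0) andbF orbF.
    have Q0 : Q != 0 by apply: contraTneq (separable_poly_neq0 sP) => Q0; rewrite QE Q0 mul0r eqxx.
    by have := dvdp_leq Q0 (minP _ LQ Qx); rewrite QE size_mulX ?ltnn.
  exists (P \Po 'X^p); split.
  - apply/polyOverP => i; rewrite coef_comp_poly_Xn ?prime_gt0 //.
    by case: ifP => _; rewrite ?rpred0 //; apply/polyOverP.
  - rewrite unlock deriv_comp derivXn.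
    rewrite coprimepMr coprimep_comp_poly /=; last by move: sP; rewrite unlock.
    rewrite -scaler_nat coprimepZr // coprimep_expr // coprimepX.
    by rewrite rootE horner_comp hornerXn expr0n -leqn0 leqNgt prime_gt0 //= horner_coef0.
  - by rewrite rootE horner_comp hornerXn.
apply/max_p_adjoinP; split=> // g gL; have [a ga] := xt g gL.
exists a.+1; set h := (g ^+ (p ^ a))%g in ga *.
have hL : {in L, ev h =1 id} by move=> z Lz; rewrite ev_fixX // gL.
have Ay : y \in A by exact: sepover_in adjoin_roots_alg _ sy.
have yyL : ev h y / y \in L.
  apply: adjoin_roots_unity; rewrite exprMn exprVn -ev_exp // ga mulfV //.
  by rewrite expf_neq0.
have hE : ev h y = ev h y / y * y by rewrite mulfVK.
rewrite expnSr expgM -/h.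
suff hX n : ev (h ^+ n)%g y = (ev h y / y) ^+ n * y.
  by rewrite hX exprMn exprVn -ev_exp // ga mulfV ?mul1r // expf_neq0.
elim: n => [|n IHn]; first by rewrite ev1 expr0 mul1r.
have yynL : (ev h y / y) ^+ n \in L by rewrite rpredX.
rewrite expgS evM IHn ev_mul //; last exact: adjoin_roots_alg.
rewrite (hL _ yynL).
by rewrite exprSr -mulrA -hE.
Qed.

Lemma unity_root_max_p x m : x ^+ (p ^ m) = 1 -> x \in Lp.
Proof.
elim: m x => [|m IHm] x; first by rewrite expr1 => ->; rewrite rpred1.
by rewrite expnS exprM => /IHm/max_p_root_closed.
Qed.

End Setup.

(** * The group Gal(L(p)/F) *)

Section GaloisGroup.
Variables (Omega : closedFieldType) (F : subfield Omega) (p : nat).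
Hypotheses (p_prime : prime p) (p_neq0 : p%:R != 0 :> Omega).
Local Notation A := (alg_closure F).
Local Notation L := (adjoin_roots p F).
Local Notation Lp := (max_p_extension p L).
Local Notation Fp := (max_p_extension p F).
Local Notation GG := (gal Lp F).
Implicit Types (g h u : GG) (x y z : Omega).

Let LpA : {subset Lp <= A}. Proof. exact: max_p_alg. Qed.
Let FpLp : {subset Fp <= Lp}. Proof. exact: max_p_base_sub. Qed.
Let LLp : {subset L <= Lp}. Proof. exact: max_p_sub. Qed.
Let FLp : {subset F <= Lp}.
Proof. by move=> x /adjoin_roots_base/LLp. Qed.

Lemma gal_max_p_extend g : exists h : gal A F, {in Lp, ev h =1 ev g}.
Proof. exact: gal_extend_alg. Qed.

Lemma gal_max_p_restrict (h : gal A F) : exists g, {in Lp, ev g =1 ev h}.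
Proof. by apply: gal_restrict_stable => // h' x; apply: max_p_stable. Qed.

Lemma torsion_adjoin g x : {in L, ev g =1 id} -> x \in Lp ->
  exists a, ev (g ^+ (p ^ a))%g x = x.
Proof.
move=> gL Lpx; have [h hg] := gal_max_p_extend g.
have /(max_p_adjoinP F p_prime p_neq0)[_ xt] := Lpx.
have [|a ha] := xt h; first by move=> y Ly; rewrite hg ?gL ?LLp.
by exists a; rewrite -(ev_agreeX _ hg).
Qed.

Lemma torsion_base g x : x \in Fp -> exists a, ev (g ^+ (p ^ a))%g x = x.
Proof.
move=> Fpx; have [h hg] := gal_max_p_extend g.
have /(max_p_baseP F p_prime)[_ /(_ h)[a ha]] := Fpx.
by exists a; rewrite -(ev_agreeX _ hg) // FpLp.
Qed.

Lemma ev_unity_root g z n : n.-primitive_root z -> z \in Lp ->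
  exists i, [/\ (i < n)%N, coprime i n & ev g z = z ^+ i].
Proof.
move=> zP Lpz; have gzn : ev g z ^+ n = 1 by rewrite -ev_exp // prim_expr_order // ev_1.
have [i gz] := prim_rootP zP gzn; exists i; split=> //.
rewrite -(prim_root_exp_coprime i zP) -gz.
apply/andP; split; first exact: prim_order_gt0 zP.
apply/forallP => k; rewrite unity_rootE -ev_exp // -{1}(ev_1 g) (inj_eq (@ev_inj _ _ _ g)).
by have /andP[_ /forallP/(_ k)] := zP; rewrite unity_rootE.
Qed.

Lemma ev_unity_rootX g z i n : z \in Lp -> ev g z = z ^+ i ->
  ev (g ^+ n)%g z = z ^+ (i ^ n).
Proof.
move=> Lpz gz; elim: n => [|n IHn]; first by rewrite ev1 expr1.
by rewrite expgS evM IHn ev_exp // gz -exprM expnS.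
Qed.

Lemma unity_root_in_max_p x : x ^+ p = 1 -> x \in Lp.
Proof. by move=> /adjoin_roots_unity/LLp. Qed.

(** Gal(L/F) acts on mu_p through the units modulo p, whose exponent divides p - 1. *)
Lemma expg_predp_fix g : {in L, ev (g ^+ p.-1)%g =1 id}.
Proof.
apply: fix_adjoin_roots => // x xp; have [z zP] := prim_root_exists p_neq0.
have Lpz : z \in Lp by apply: unity_root_in_max_p; rewrite prim_expr_order.
have [k ->] := prim_rootP zP xp; rewrite ev_exp //; congr (_ ^+ _).
have [i [_ cop gz]] := ev_unity_root g zP Lpz.
rewrite (ev_unity_rootX _ Lpz gz); apply/eqP.
rewrite -[X in _ == X]expr1 (eq_prim_root_expr zP).
by rewrite -(totient_prime p_prime) Euler_exp_totient.
Qed.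

Let stab g x a := ev ((g ^+ p.-1) ^+ (p ^ a))%g x = x.

Let stab_exists g x : x \in Lp -> exists a, stab g x a.
Proof. by apply: torsion_adjoin; apply: expg_predp_fix. Qed.

Let stabW g x a b : (a <= b)%N -> stab g x a -> stab g x b.
Proof. by move=> ab; apply: ev_fix_leq. Qed.

(** The values g^(p^b) x become stationary: p^(b+1) = p^b + (p-1) p^b, and the second summand acts
    trivially on x. This makes the limit of g^(p^b) meaningful. *)
Let stab_step g x a b : (a <= b)%N -> stab g x a ->
  ev (g ^+ (p ^ b))%g x = ev (g ^+ (p ^ a))%g x.
Proof.
move=> /subnKC <- ga; elim: (b - a)%N => [|n IHn]; first by rewrite addn0.
have pE : (p ^ (a + n) * p = p ^ (a + n) + p.-1 * p ^ (a + n))%N.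
  by rewrite -mulSn prednK ?prime_gt0 // mulnC.
rewrite addnS expnSr -IHn pE expgD evM expgM; congr (ev _ _).
by apply: stabW ga; apply: leq_addr.
Qed.

Let stabV g x a : stab g x a -> stab g^-1%g x a.
Proof. by rewrite /stab !expVgn => /ev_fixV. Qed.

(* The limit of g ^+ (p ^ a) is trivial on F(p), where g has p-power order at
   each point, and equals g on L, because p = 1 mod p - 1. *)
Lemma gal_decomposition g : exists h u,
  [/\ (g = h * u)%g, {in Fp, ev h =1 id} & {in L, ev u =1 id}].
Proof.
have /choice[a aP] : forall x, exists a, x \in Lp -> stab g x a.
  by move=> x; have [/(stab_exists g)[a ?]|_] := boolP (x \in Lp); [exists a|exists 0%N].
pose f x := ev (g ^+ (p ^ a x))%g x.
pose f' x := ev (g^-1 ^+ (p ^ a x))%g x.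
have fE x b : x \in Lp -> (a x <= b)%N -> f x = ev (g ^+ (p ^ b))%g x.
  by move=> /aP sx /stab_step ->.
have f'E x b : x \in Lp -> (a x <= b)%N -> f' x = ev (g^-1 ^+ (p ^ b))%g x.
  by move=> /aP/stabV sx /stab_step ->.
have Lpf : {in Lp, forall x, f x \in Lp} by move=> x; apply: ev_in.
have Lpf' : {in Lp, forall x, f' x \in Lp} by move=> x; apply: ev_in.
have fB : {in Lp &, forall x y, f (x - y) = f x - f y}.
  move=> x y Lx Ly; have Lxy : x - y \in Lp by rewrite rpredB.
  pose b := maxn (a (x - y)) (maxn (a x) (a y)).
  by rewrite !(fE _ b) ?evB // ?leq_maxl // !leq_max leqnn ?orbT.
have fM : {in Lp &, forall x y, f (x * y) = f x * f y}.
  move=> x y Lx Ly; have Lxy : x * y \in Lp by rewrite rpredM.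
  pose b := maxn (a (x * y)) (maxn (a x) (a y)).
  by rewrite !(fE _ b) ?ev_mul // ?leq_maxl // !leq_max leqnn ?orbT.
have fK : {in Lp, cancel f f'}.
  move=> x Lx; pose b := maxn (a x) (a (f x)).
  by rewrite (f'E _ b) ?leq_maxr ?Lpf // (fE _ b) ?leq_maxl // expVgn evK.
have f'K : {in Lp, cancel f' f}.
  move=> x Lx; pose b := maxn (a x) (a (f' x)).
  by rewrite (fE _ b) ?leq_maxr ?Lpf' // (f'E _ b) ?leq_maxl // expVgn evVK.
have fF : {in F, forall x, f x = x} by move=> x Fx; rewrite /f ev_fix.
have [h hf] := gal_build Lpf Lpf' fK f'K fB fM (ev_1 _) fF.
exists h, (h^-1 * g)%g; split; first by rewrite mulKVg.
- move=> x Fx; rewrite hf ?FpLp //; have [b gb] := torsion_base g Fx.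
  rewrite (fE _ (maxn b (a x))) ?leq_maxr ?FpLp //.
  exact: ev_fix_leq (leq_maxl _ _) gb.
- apply: fix_adjoin_roots => // x xp; rewrite evM.
  have Lpx : x \in Lp by exact: unity_root_in_max_p.
  apply: (can_inj (evK h)); rewrite evVK hf // /f.
  have [z zP] := prim_root_exists p_neq0.
  have Lpz : z \in Lp by apply: unity_root_in_max_p; rewrite prim_expr_order.
  have [k ->] := prim_rootP zP xp; rewrite !ev_exp //; congr (_ ^+ _).
  have [i [_ _ gz]] := ev_unity_root g zP Lpz.
  rewrite (ev_unity_rootX _ Lpz gz) gz; apply/eqP; rewrite (eq_prim_root_expr zP) eq_sym.
  elim: (a _) => [|n IHn]; first by rewrite expn1.
  by rewrite expnSr expnM -modnXm (eqP IHn) modnXm fermat_little.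
Qed.

(* An element fixed by U has p-power torsion under the Galois group, so it lies
   in F(p); hence U is determined inside a finite Galois extension by its action
   on elements of F(p). *)
Lemma open_subgroup (U : set GG) (e : seq Omega) :
    U 1%g -> (forall g h, U g -> U h -> U (g * h)%g) -> (forall g, U g -> U g^-1%g) ->
    {subset e <= Lp} -> (forall g, {in e, ev g =1 id} -> U g) ->
    (forall g, exists a, U (g ^+ (p ^ a))%g) ->
  exists2 e' : seq Omega, {subset e' <= Fp} & forall g, {in e', ev g =1 id} -> U g.
Proof.
move=> U1 UM UV eLp Ue Up.
have [||x /eLp/(max_p_adjoinP F p_prime p_neq0)[+ _]|E [j [rs [jA galE _ ej _]]]] :=
  @galois_embedding _ F F _ _ e.
- by [].
- exact: sub_alg_closure.
- exact: sepover_trans.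
have AF := @sub_alg_closure _ F.
(* H is the image of U in Gal(E/F). It passes through automorphisms of A, because E has been
   embedded in A rather than in L(p). *)
pose inH (s : gal_of {:E}%AS) := exists (h : gal A F) u,
  [/\ U u, {in Lp, ev h =1 ev u} & forall c, ev h (j c) = j (s c)].
have H_group : group_set (finset (fun s => `[< inH s >])).
  apply/group_setP; split.
    rewrite finset.inE; apply/asboolP; exists 1%g, 1%g; split=> // [x|c]; rewrite !ev1 //.
    by rewrite gal_id.
  move=> s t; rewrite !finset.inE => /asboolP[h [u [Uu hu hs]]] /asboolP[h' [u' [Uu' hu' ht]]].
  apply/asboolP; exists (h' * h)%g, (u' * u)%g; split; first exact: UM.
    by move=> x Lx; rewrite !evM hu // hu' // ev_in.
  by move=> c; rewrite evM hs ht galM ?memvf.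
pose H := Group H_group.
pose X := fixedField H.
have XFp (x : E) : x \in X -> j x \in Fp.
  move=> /mem_fixedFieldP[_ Xx]; apply/(max_p_baseP F p_prime); split.
    exact: embedded_sepover.
  move=> h; have [u uh] := gal_max_p_restrict h; have [a Ua] := Up u; exists a.
  have [s hs] := gal_restrict AF jA galE (fun y Fy => ev_fix (h ^+ (p ^ a))%g Fy).
  rewrite hs Xx // finset.inE; apply/asboolP; exists (h ^+ (p ^ a))%g, (u ^+ (p ^ a))%g.
  by split=> // x' Lx'; rewrite (ev_agreeX _ (fun y Ly => esym (uh y Ly))).
exists (map j (vbasis X)) => [_ /mapP[x /vbasis_mem Xx ->]|g gX]; first exact: XFp.
have [h hg] := gal_max_p_extend g.
have [s hs] := gal_restrict AF jA galE (fun y Fy => ev_fix h Fy).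
have : s \in 'Gal({:E} / X)%g.
  have sub : (X <= fixedSpace s)%VS.
    rewrite -{1}(span_basis (vbasisP X)); apply/span_subvP => y yX.
    apply/fixedSpaceP; apply: (fmorph_inj j).
    by rewrite -hs hg ?gX ?map_f // FpLp // XFp // vbasis_mem.
  rewrite gal_kHom ?subvf //; apply/kAHomP => y Xy.
  exact/fixedSpaceP/(subvP sub).
(* By the Galois correspondence Gal(E/X) = H, so g agrees on e with some u of U, and u^-1 g fixes
   e. *)
rewrite gal_fixedField finset.inE => /asboolP[h' [u [Uu hu hs']]].
rewrite -(mulKVg u g); apply: UM => //; apply: Ue => x ex.
have Lx := eLp x ex; have /mapP[c _ xc] := ej x ex.
apply: (can_inj (evK u)); rewrite evM evVK -hu // -hg // xc hs' hs.
by [].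
Qed.

End GaloisGroup.

(** * The cyclotomic character and theta *)

Section Theta.
Variables (Omega : closedFieldType) (F : subfield Omega) (p n : nat).
Hypotheses (p_prime : prime p) (p_neq0 : p%:R != 0 :> Omega) (n_gt0 : (0 < n)%N).
Local Notation A := (alg_closure F).
Local Notation L := (adjoin_roots p F).
Local Notation Lp := (max_p_extension p L).
Local Notation Fp := (max_p_extension p F).
Local Notation GG := (gal Lp F).
Local Notation m := (p ^ n)%N.
Implicit Types (g h u : GG) (w : mu Lp m).

Let m_gt1 : (1 < m)%N.
Proof. by rewrite -{1}(expn0 p) ltn_exp2l ?prime_gt1. Qed.

Definition mu_root w : Omega := val (mu_val w).

Lemma mu_root_inj : injective mu_root.
Proof. by move=> w w' /val_inj/val_inj. Qed.

Lemma mu_root_in w : mu_root w \in Lp. Proof. exact: elt_valP. Qed.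

Lemma mu_rootM w w' : mu_root (w * w')%g = mu_root w * mu_root w'.
Proof. by rewrite /mu_root -rmorphM. Qed.

Lemma mu_root1 : mu_root 1%g = 1.
Proof. by []. Qed.

Lemma mu_rootX w k : mu_root (w ^+ k)%g = mu_root w ^+ k.
Proof.
elim: k => [|k IHk]; first by rewrite expg0 mu_root1 expr0.
by rewrite expgS exprS mu_rootM IHk.
Qed.

Lemma mu_root_expm w : mu_root w ^+ m = 1.
Proof.
have /andP[_ /eqP wm] := mu_valP w.
by rewrite /mu_root -rmorphXn /= wm.
Qed.

Lemma mu_root_gal g w : mu_root (gal_mu g w) = ev g (mu_root w).
Proof. by rewrite /mu_root ev_val. Qed.

Lemma mu_root_surj x : x ^+ m = 1 -> exists w, mu_root w = x.
Proof.
move=> xm; have Lx : x \in Lp by apply: unity_root_max_p xm.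
have wP : (SubfieldElt Lx \is a GRing.unit) && (SubfieldElt Lx ^+ m == 1).
  have xm1 : SubfieldElt Lx ^+ m = 1 by apply: val_inj; rewrite rmorphXn.
  rewrite xm1 eqxx andbT -(unitrX_pos _ (ltnW m_gt1)) xm1; exact: unitr1.
by exists (Mu wP).
Qed.

Lemma mu_mulC w w' : (w * w' = w' * w)%g.
Proof. by apply: mu_root_inj; rewrite !mu_rootM mulrC. Qed.

Lemma mu_prim_root : exists w, m.-primitive_root (mu_root w).
Proof.
have [z zP] := prim_root_exists (natrX_neq0 p_neq0 n).
by have [w wz] := mu_root_surj (prim_expr_order zP); exists w; rewrite wz.
Qed.

Lemma expg_unitM w (a b : {unit 'Z_m}) :
  (w ^+ (val (a * b)%g : 'Z_m) = (w ^+ (val a : 'Z_m)) ^+ (val b : 'Z_m))%g.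
Proof.
apply: mu_root_inj; rewrite !mu_rootX -exprM /= /Zp_mul.
rewrite -[in RHS](expr_mod _ (mu_root_expm w)); congr (_ ^+ _) => /=.
by move: (_ * _)%N => k; rewrite Zp_cast.
Qed.

Lemma expg_unit1 w : (w ^+ (val (1%g : {unit 'Z_m}) : 'Z_m) = w)%g.
Proof. by rewrite /= /Zp1 /= modn_small ?expg1. Qed.

Lemma expg_unit_inj w (a b : {unit 'Z_m}) : m.-primitive_root (mu_root w) ->
  (w ^+ (val a : 'Z_m) = w ^+ (val b : 'Z_m))%g -> a = b.
Proof.
move=> wP /(congr1 mu_root); rewrite !mu_rootX => /eqP.
rewrite (eq_prim_root_expr wP) => /eqP ab; apply/val_inj/val_inj => /=.
have lt_m (i : 'Z_m) : (i < m)%N by have := ltn_ord i; rewrite [X in (_ < X)%N]Zp_cast.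
by move: ab; rewrite !modn_small.
Qed.

(** The default in [cyclotomic] is never taken: the exponent by which g acts on one primitive root
    is a unit and serves all its powers. *)
Lemma cyclotomicP g w : gal_mu g w = (w ^+ (val (cyclotomic n g) : 'Z_m))%g.
Proof.
rewrite /cyclotomic; case: xgetP => [a -> -> //|noa]; exfalso.
have [w0 wP] := mu_prim_root.
have [i [ltim copim gw]] := ev_unity_root g wP (mu_root_in w0).
have ui : (i%:R : 'Z_m) \is a GRing.unit by rewrite unitZpE // coprime_sym.
apply: (noa (FinRing.Unit ui)) => w'; apply: mu_root_inj.
rewrite mu_root_gal mu_rootX /= val_Zp_nat // modn_small //.
have [k ->] := prim_rootP wP (mu_root_expm w').
by rewrite ev_exp ?mu_root_in // gw -!exprM mulnC.
Qed.

End Theta.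

(** * The twisted action of Gal(L(p)/F) on the roots of unity *)

Section TwistedAction.
Variables (Omega : closedFieldType) (F : subfield Omega) (p n : nat).
Hypotheses (p_prime : prime p) (p_neq0 : p%:R != 0 :> Omega) (n_gt0 : (0 < n)%N).
Local Notation A := (alg_closure F).
Local Notation L := (adjoin_roots p F).
Local Notation Lp := (max_p_extension p L).
Local Notation Fp := (max_p_extension p F).
Local Notation GG := (gal Lp F).
Local Notation m := (p ^ n)%N.
Implicit Types (g h u : GG) (w : mu Lp m).

Lemma gal_muM g h w : gal_mu (g * h)%g w = gal_mu g (gal_mu h w).
Proof. by apply: mu_root_inj; rewrite !mu_root_gal evM. Qed.

Lemma gal_muX g w k : gal_mu g (w ^+ k)%g = (gal_mu g w ^+ k)%g.
Proof.
apply: mu_root_inj; rewrite mu_root_gal !mu_rootX mu_root_gal.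
by rewrite ev_exp // mu_root_in.
Qed.

Lemma cyclotomic_inj w g (a : {unit 'Z_m}) : m.-primitive_root (mu_root w) ->
  gal_mu g w = (w ^+ (val a : 'Z_m))%g -> cyclotomic n g = a.
Proof.
move=> wP; rewrite (cyclotomicP p_prime p_neq0 n_gt0 g) => E.
exact: expg_unit_inj E.
Qed.

Lemma cyclotomicM : {morph (@cyclotomic Omega p F n) : g h / (g * h)%g}.
Proof.
move=> g h; have [w wP] := mu_prim_root F p_prime p_neq0 n_gt0.
apply: (cyclotomic_inj wP); rewrite gal_muM.
rewrite (cyclotomicP p_prime p_neq0 n_gt0 h) gal_muX (cyclotomicP p_prime p_neq0 n_gt0 g).
by rewrite expg_unitM.
Qed.

Lemma cyclotomic1 : cyclotomic n (1%g : GG) = 1%g.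
Proof. by have /esym := cyclotomicM 1%g 1%g; rewrite mulg1 -[RHS]mulg1 => /mulgI. Qed.

Lemma cyclotomicX g k : cyclotomic n (g ^+ k)%g = (cyclotomic n g ^+ k)%g.
Proof. by elim: k => [|k IHk]; rewrite ?expg0 ?cyclotomic1 // !expgS cyclotomicM IHk. Qed.

Lemma cyclotomic_fix w g : m.-primitive_root (mu_root w) ->
  ev g (mu_root w) = mu_root w -> cyclotomic n g = 1%g.
Proof.
move=> wP gw; apply: (cyclotomic_inj wP); rewrite expg_unit1 //.
by apply: mu_root_inj; rewrite mu_root_gal.
Qed.

Lemma cyclotomic_adjoin g : {in L, ev g =1 id} ->
  exists a, (cyclotomic n g ^+ (p ^ a) = 1)%g.
Proof.
move=> gL; have [w wP] := mu_prim_root F p_prime p_neq0 n_gt0.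
have [a ga] := torsion_adjoin p_prime p_neq0 gL (mu_root_in w).
by exists a; rewrite -cyclotomicX; apply: cyclotomic_fix ga.
Qed.

Lemma fixingP (M : subfield Omega) g : {subset M <= Lp} ->
  fixing M g <-> {in M, ev g =1 id}.
Proof.
move=> MLp; split=> [gM x Mx|gM x Mx].
  have Lx := MLp x Mx; rewrite -[x in LHS]/(val (SubfieldElt Lx)) ev_val.
  by rewrite gM.
by apply: val_inj; rewrite -ev_val gM.
Qed.

(** Write q = p^(n-1). As g^(p-1) fixes L, its alpha has p-power order, and p - 1 divides q - 1; so
    the open subgroup where alpha^(q-1) = 1 contains a p-power of every g, hence contains N. On G_L
    the order of alpha is a power of p that divides (p-1) q, hence divides q. *)
Lemma theta_exists : is_theta (fun g => (cyclotomic n g ^+ (p ^ n.-1))%g).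
Proof.
set q := (p ^ n.-1)%N.
have predq : q.-1 = (p.-1 * \sum_(i < n.-1) p ^ i)%N by rewrite predn_exp.
have q_gt0 : (0 < q)%N by rewrite expn_gt0 prime_gt0.
split.
- by move=> g h; rewrite cyclotomicM expgMn //; apply: unit_Zp_mulgC.
- move=> g /fixingP gFp; have {}gFp := gFp (@max_p_base_sub _ F p p_prime p_neq0).
  have [w wP] := mu_prim_root F p_prime p_neq0 n_gt0.
  pose U := [set g : GG | (cyclotomic n g ^+ q.-1 = 1)%g].
  have Uw h : {in [:: mu_root w], ev h =1 id} -> U h.
    move=> hw; rewrite /U /= (cyclotomic_fix wP) ?expg1n //.
    by apply: hw; rewrite inE.
  have UM h h' : U h -> U h' -> U (h * h')%g.
    rewrite /U /= => Uh Uh'; rewrite cyclotomicM expgMn; last exact: unit_Zp_mulgC.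
    by rewrite Uh Uh' mulg1.
  have UV h : U h -> U h^-1%g.
    rewrite /U /= => Uh; apply: (mulgI (cyclotomic n h ^+ q.-1)%g).
    rewrite -expgMn; last exact: unit_Zp_mulgC.
    by rewrite -cyclotomicM mulgV cyclotomic1 expg1n Uh mulg1.
  have Up h : exists a, U (h ^+ (p ^ a))%g.
    have [a ha] := cyclotomic_adjoin (expg_predp_fix p_prime p_neq0 h); exists a.
    rewrite /U /= cyclotomicX -expgM predq mulnA [(_ * p.-1)%N]mulnC expgM expgM.
    by rewrite -cyclotomicX ha expg1n.
  have [||e' e'Fp Ue'] := open_subgroup p_prime p_neq0 (Uw 1%g _) UM UV _ Uw Up.
  + by move=> x _; rewrite ev1.
  + by move=> x; rewrite inE => /eqP ->; apply: mu_root_in.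
  have := Ue' g (fun x e'x => gFp x (e'Fp x e'x)); rewrite /U /= => gq1.
  by rewrite -(prednK q_gt0) expgS gq1 mulg1.
- move=> g /fixingP gL; have {}gL := gL (@max_p_sub _ F p).
  have [a ga] := cyclotomic_adjoin gL; apply/eqP; rewrite -order_dvdn.
  have o1 : (#[cyclotomic n g]%g %| p ^ a)%N by rewrite order_dvdn ga.
  have o2 : (#[cyclotomic n g]%g %| p.-1 * q)%N.
    rewrite -(totient_pfactor p_prime n_gt0) -card_units_Zp ?expn_gt0 ?prime_gt0 //.
    by apply: order_dvdG; rewrite /units_Zp finset.inE.
  have cop : coprime #[cyclotomic n g]%g p.-1.
    by apply: coprime_dvdl o1 _; apply: coprimeXl; rewrite coprimenP ?prime_gt0.
  by rewrite -(Gauss_dvdr q cop).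
Qed.

Lemma thetaP : is_theta (@theta Omega p F n).
Proof. by apply: (xgetPex _ (ex_intro _ _ theta_exists)). Qed.

Lemma twisted_action_fix_adjoin g w : {in L, ev g =1 id} ->
  twisted_action g w = gal_mu g w.
Proof.
move=> gL; have [_ _ tL] := thetaP; rewrite /twisted_action tL; last first.
  by apply/fixingP => //; apply: max_p_sub.
by rewrite invg1 expg_unit1.
Qed.

Lemma twisted_action_fix_base g w : {in Fp, ev g =1 id} -> twisted_action g w = w.
Proof.
move=> gF; have [_ tN _] := thetaP; rewrite /twisted_action tN; last first.
  by apply/fixingP => //; apply: max_p_base_sub.
by rewrite (cyclotomicP p_prime p_neq0 n_gt0) -expg_unitM // mulgV expg_unit1.
Qed.

Lemma twisted_actionM g h w :
  twisted_action (g * h)%g w = twisted_action g (twisted_action h w).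
Proof.
have [tM _ _] := thetaP; rewrite /twisted_action tM gal_muM gal_muX -expg_unitM //.
by rewrite invMg.
Qed.

Lemma mu_expgM w w' k : ((w * w') ^+ k = w ^+ k * w' ^+ k)%g.
Proof. by apply: expgMn; apply: mu_mulC. Qed.

Lemma gal_mu_mul g w w' : gal_mu g (w * w')%g = (gal_mu g w * gal_mu g w')%g.
Proof.
by apply: mu_root_inj; rewrite mu_root_gal !mu_rootM !mu_root_gal ev_mul ?mu_root_in.
Qed.

Lemma twisted_action_mul g w w' :
  twisted_action g (w * w')%g = (twisted_action g w * twisted_action g w')%g.
Proof. by rewrite /twisted_action gal_mu_mul mu_expgM. Qed.

Lemma twisted_action_decomposition g : exists2 u : GG,
  {in L, ev u =1 id} & forall w, twisted_action g w = gal_mu u w.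
Proof.
have [h [u [-> hF uL]]] := gal_decomposition p_prime p_neq0 g; exists u => // w.
by rewrite twisted_actionM twisted_action_fix_base // twisted_action_fix_adjoin.
Qed.

(** Elements of G_L have p-power torsion on L(p), and g acts as one of them. *)
Lemma twisted_action_torsion g :
  exists a, forall w, twisted_action (g ^+ (p ^ a))%g w = w.
Proof.
have [u uL gu] := twisted_action_decomposition g.
have [w wP] := mu_prim_root F p_prime p_neq0 n_gt0.
have [a ua] := torsion_adjoin p_prime p_neq0 uL (mu_root_in w).
have gX k w' : twisted_action (g ^+ k)%g w' = gal_mu (u ^+ k)%g w'.
  elim: k w' => [|k IHk] w'.
    rewrite !expg0 twisted_action_fix_base; last by move=> x _; rewrite ev1.
    by apply: mu_root_inj; rewrite mu_root_gal ev1.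
  by rewrite !expgS twisted_actionM gal_muM IHk gu.
exists a => w'; rewrite gX; apply: mu_root_inj; rewrite mu_root_gal.
have [k ->] := prim_rootP wP (mu_root_expm w').
by rewrite ev_exp ?mu_root_in // ua.
Qed.

End TwistedAction.

(** * Kummer theory *)

Section Kummer.
Variables (Omega : closedFieldType) (F : subfield Omega) (p : nat).
Hypotheses (p_prime : prime p) (p_neq0 : p%:R != 0 :> Omega).
Local Notation A := (alg_closure F).
Local Notation L := (adjoin_roots p F).
Local Notation Lp := (max_p_extension p L).
Local Notation GG := (gal Lp F).

(** Hilbert 90: c factors on G_L through a finite Galois group Gal(E/L), where a Lagrange resolvent
    trivialises it. *)
Lemma kummer_generator (c : GG -> Omega) (e : seq Omega) :
    {morph c : g h / (g * h)%g >-> g * h} -> (forall g, c g ^+ p = 1) ->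
    {subset e <= Lp} -> (forall g, {in e, ev g =1 id} -> c g = 1) ->
  exists b, [/\ b \in Lp, b != 0 & forall g : GG, {in L, ev g =1 id} -> ev g b = c g * b].
Proof.
move=> cM cp eLp ce.
have FL := @adjoin_roots_base _ F p.
have LA := @adjoin_roots_alg _ F p p_neq0.
have LpA := max_p_alg p_prime p_neq0 (F := F).
have [|E [j [rs [jA galE _ ej _]]]] := @galois_embedding _ F L FL LA e.
  by move=> x /eLp/(max_p_adjoinP F p_prime p_neq0)[].
have cL g : c g \in L by apply: adjoin_roots_unity.
have c0 g : c g != 0.
  apply/eqP => cg0; have /eqP := cp g.
  by rewrite cg0 expr0n gtn_eqF ?prime_gt0 // eq_sym oner_eq0.
have /choice[u uP] : forall s : gal_of {:E}%AS, exists u : GG,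
    {in L, ev u =1 id} /\ forall x, x \in Lp -> forall y, x = j y -> ev u x = j (s y).
  move=> s; have [h [hL hs]] := gal_lift FL LA jA galE s.
  have [u uh] := gal_max_p_restrict p_prime p_neq0 h; exists u; split.
    by move=> x Lx; rewrite uh ?hL // max_p_sub.
  by move=> x Lx y xy; rewrite uh // xy hs.
(* The image of E contains e, so c depends only on the restriction of g to E. *)
have cE (g : GG) (s : gal_of {:E}%AS) :
    (forall x, x \in Lp -> forall y, x = j y -> ev g x = j (s y)) -> c g = c (u s).
  move=> gs; rewrite -[in LHS](mulKVg (u s) g) cM [X in _ * X]ce ?mulr1 // => x ex.
  have Lx := eLp x ex; have /mapP[y _ xy] := ej x ex; have [_ us] := uP s.
  by apply: (can_inj (evK (u s))); rewrite evM evVK (gs x Lx y) // (us x Lx y).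
have kM s t : c (u (s * t)%g) = c (u t) * c (u s).
  rewrite -cM; apply/esym/cE => x Lx y xy; have [[_ us] [_ ut]] := (uP s, uP t).
  rewrite evM (ut _ _ (s y)) ?galM ?memvf ?(us x Lx y) //.
  by rewrite -(us x Lx y xy) ev_in.
pose k s : L := SubfieldElt (cL (u s)).
have kM' s t : k (s * t)%g = k t * k s by apply: val_inj; rewrite rmorphM /= kM.
have k0 s : k s != 0 by rewrite -(inj_eq val_inj) /= c0.
have k1 : (k 1%g)^-1%:A != 0 :> E by rewrite scaler_eq0 oner_eq0 orbF invr_eq0.
(* Independence of automorphisms provides y for which the resolvent b, the sum of k(s)^-1 s(y), does
   not vanish. *)
have [y _] := @gal_independent_contra _ _ _ predT (fun s => (k s)^-1%:A) 1%g isT k1.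
under eq_bigr => s _ do rewrite mulr_algl.
set b := \sum_(s | _) _ => b0.
have bs (t : gal_of {:E}%AS) : t b = k t *: b.
  rewrite linear_sum scaler_sumr /= [RHS](reindex_inj (mulIg t)) /=.
  apply: eq_bigr => s _; rewrite linearZ /= galM ?memvf // scalerA kM' invfM.
  by rewrite mulrA mulfV // mul1r.
have jb (s : gal_of {:E}%AS) : j (s b) = c (u s) * j b by rewrite bs -mulr_algl rmorphM jA.
(* h multiplies j b by a p-th root of unity that it fixes, so h^p fixes j b. *)
have Lb : j b \in Lp.
  apply/(max_p_adjoinP F p_prime p_neq0); split; first exact: embedded_sepover.
  move=> h hL; have [s hs] := gal_restrict LA jA galE hL; exists 1%N.
  suff hX i : ev (h ^+ i)%g (j b) = c (u s) ^+ i * j b by rewrite hX expn1 cp mul1r.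
  elim: i => [|i IHi]; first by rewrite ev1 expr0 mul1r.
  have cX : c (u s) ^+ i \in L by rewrite rpredX.
  rewrite expgS evM IHi (ev_mul _ (LA _ cX) (embedded_in LA jA galE b)).
  by rewrite (hL _ cX) hs jb mulrA -exprSr.
exists (j b); split=> //; first by rewrite fmorph_eq0.
move=> g gL; have [h hg] := gal_max_p_extend p_prime p_neq0 g.
have hL : {in L, ev h =1 id} by move=> x Lx; rewrite hg ?gL ?max_p_sub.
have [s hs] := gal_restrict LA jA galE hL.
rewrite -hg // hs jb (cE g s) // => x Lx z xz.
by rewrite -hg // xz hs.
Qed.

End Kummer.

(** * Transfer from Gal(L(p)/L) *)

Section Transfer.
Variables (Omega : closedFieldType) (F : subfield Omega) (p n : nat).
Hypotheses (p_prime : prime p) (p_neq0 : p%:R != 0 :> Omega) (n_gt0 : (0 < n)%N).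
Local Notation A := (alg_closure F).
Local Notation L := (adjoin_roots p F).
Local Notation Lp := (max_p_extension p L).
Local Notation Fp := (max_p_extension p F).
Local Notation GG := (gal Lp F).
Local Notation m := (p ^ n)%N.
Local Notation q := (p ^ n.-1)%N.
Implicit Types (g h u : GG) (w : mu Lp m).

Let LLp : {subset L <= Lp}. Proof. exact: max_p_sub. Qed.

Lemma mu_root_neq0 w : mu_root w != 0.
Proof. by have /andP[+ _] := mu_valP w; rewrite unitfE -(inj_eq val_inj). Qed.

Lemma twisted_action1 g : twisted_action g (1%g : mu Lp m) = 1%g.
Proof.
have := twisted_action_mul g (1%g : mu Lp m) 1%g.
by rewrite mulg1 -{1}[twisted_action _ _]mulg1 => /mulgI.
Qed.

Lemma twisted_actionX g w k : twisted_action g (w ^+ k)%g = (twisted_action g w ^+ k)%g.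
Proof.
by elim: k => [|k IHk]; rewrite ?expg0 ?twisted_action1 // !expgS twisted_action_mul IHk.
Qed.

(** The product is formed in Omega, where commutativity is available; w0 names the root of unity
    that it equals. *)
Lemma twisted_action_prod g (I : finType) (w : I -> mu Lp m) (w0 : mu Lp m) :
  mu_root w0 = \prod_i mu_root (w i) ->
  mu_root (twisted_action g w0) = \prod_i mu_root (twisted_action g (w i)).
Proof.
elim: (index_enum I) w0 => [|i r IHr] w0; rewrite ?big_nil ?big_cons.
  by rewrite -(mu_root1 F p n) => /mu_root_inj ->; rewrite twisted_action1.
move=> E; pose v := ((w i)^-1 * w0)%g.
have w0E : w0 = (w i * v)%g by rewrite mulKVg.
have vE : mu_root v = \prod_(k <- r) mu_root (w k).
  by move: E; rewrite w0E mu_rootM => /(mulfI (mu_root_neq0 (w i))).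
by rewrite w0E twisted_action_mul mu_rootM (IHr _ vE).
Qed.

(** The q-th power is a p-th root of unity, hence in L, and g acts as some u that fixes L. *)
Lemma mu_epi_twisted g w : mu_root (twisted_action g w) ^+ q = mu_root w ^+ q.
Proof.
have [u uL ->] := twisted_action_decomposition p_prime p_neq0 n_gt0 g.
rewrite mu_root_gal -ev_exp ?mu_root_in // uL //; apply: adjoin_roots_unity.
by rewrite -exprM -expnSr prednK // mu_root_expm.
Qed.

Section Cosets.
Variable z : Omega.
Hypothesis zP : p.-primitive_root z.

Let Lz : z \in L. Proof. by apply: adjoin_roots_unity; apply: prim_expr_order. Qed.

Lemma fix_adjoinE g : ev g z = z -> {in L, ev g =1 id}.
Proof.
move=> gz; apply: fix_adjoin_roots => // x xp; have [k ->] := prim_rootP zP xp.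
by rewrite ev_exp ?gz // LLp.
Qed.

(* Representatives of the cosets of Gal(L(p)/L), which are the fibres of
   g |-> g z. *)
Lemma coset_representatives : exists (T : finType) (s : T -> GG) (act : GG -> T -> T),
  [/\ forall g t, ev (s (act g t)) z = ev g (ev (s t) z),
      forall t t', ev (s t) z = ev (s t') z -> t = t'
    & coprime #|T| p].
Proof.
have zX g : exists i : 'I_p, ev g z = z ^+ i.
  have gzp : ev g z ^+ p = 1 by rewrite -ev_exp ?LLp // prim_expr_order // ev_1.
  by have [i gz] := prim_rootP zP gzp; exists i.
have /choice[d dP] := zX.
pose D := fun i : 'I_p => `[< exists g, d g = i >].
have /choice[s sP] : forall t : {i | D i}, exists g, d g = val t.
  by move=> t; apply/asboolP/(valP t).
have Dd g : D (d g) by apply/asboolP; exists g.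
exists {i | D i}, s, (fun g t => Sub (d (g * s t)%g) (Dd _)); split.
- by move=> g t; rewrite dP sP /= -dP evM.
- move=> t t'; rewrite !dP !sP => /eqP; rewrite (eq_prim_root_expr zP).
  by rewrite !modn_small // => /eqP/val_inj/val_inj.
- have T_gt0 : (0 < #|{: {i | D i}}|)%N by apply/card_gt0P; exists (Sub _ (Dd 1%g)).
  (* Exponent 0 is never attained, g being injective, so the number of cosets lies between 1 and p -
     1. *)
  rewrite coprime_sym prime_coprime // gtnNdvd //.
  rewrite card_sig -[X in (_ < X)%N](card_ord p); apply/proper_card/properP.
  split; first by apply/fintype.subsetP => i _; rewrite inE.
  exists (Ordinal (prime_gt0 p_prime)) => //; rewrite unfold_in.
  apply/asboolP => -[g dg]; have := dP g; rewrite dg /= expr0 => gz1.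
  have := prim_order_dvd zP 1; rewrite expr1 -(inj_eq (@ev_inj _ _ _ g)) gz1 ev_1.
  by rewrite eqxx dvdn1 gtn_eqF ?prime_gt1.
Qed.
End Cosets.


Lemma expg_root_closed k x : x ^+ (p ^ k) \in Lp -> x \in Lp.
Proof.
elim: k x => [|k IHk] x; first by rewrite expr1.
by rewrite expnS exprM => /IHk/max_p_root_closed; apply.
Qed.

Lemma kummer_cocycle (c : GG -> Omega) (e : seq Omega) :
    {morph c : g h / (g * h)%g >-> g * h} -> (forall g, c g ^+ p = 1) ->
    {subset e <= Lp} -> (forall g, {in e, ev g =1 id} -> c g = 1) ->
  exists B (f : GG -> mu Lp m), [/\ B \in Lp,
    forall g, {in L, ev g =1 id} -> ev g B = B -> f g = 1%g,
    forall g h, {in L, ev g =1 id} -> {in L, ev h =1 id} ->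
      f (g * h)%g = (f g * gal_mu g (f h))%g
    & forall g, {in L, ev g =1 id} -> mu_root (f g) ^+ q = c g].
Proof.
move=> cM cp eLp ce.
have [b [Lb b0 bP]] := kummer_generator p_prime p_neq0 cM cp eLp ce.
have sX : size ('X^q - b%:P : {poly Omega}) != 1%N.
  by rewrite size_XnsubC ?expn_gt0 ?prime_gt0 // eqSS -lt0n expn_gt0 prime_gt0.
have [B BP] := closed_rootP _ sX.
have {}BP : B ^+ q = b by apply/eqP; rewrite -subr_eq0; move: BP; rewrite rootE !hornerE.
have LB : B \in Lp by apply: (@expg_root_closed n.-1); rewrite BP.
have B0 : B != 0 by apply: contraNneq b0 => B0; rewrite -BP B0 expr0n gtn_eqF ?expn_gt0 ?prime_gt0.
have /choice[f fP] : forall g, exists w, {in L, ev g =1 id} -> mu_root w = ev g B / B.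
  move=> g; have [gL|ngL] := pselect {in L, ev g =1 id}; last by exists 1%g.
  have [|w wE] := mu_root_surj F p_prime p_neq0 n_gt0 (x := ev g B / B).
    rewrite -(prednK n_gt0) expnSr exprM exprMn exprVn -ev_exp // BP bP //.
    by rewrite mulfK // cp.
  by exists w.
have gB0 g : ev g B != 0 by rewrite -(ev_0 g) (inj_eq (@ev_inj _ _ _ g)).
exists B, f; split=> //.
- by move=> g gL gB; apply: mu_root_inj; rewrite fP // gB mulfV // mu_root1.
- move=> g h gL hL; apply: mu_root_inj; rewrite mu_rootM mu_root_gal !fP //.
    rewrite evM ev_mul ?rpredV ?ev_in // ev_V.
    by rewrite [RHS]mulrCA [X in _ = _ * X]mulrAC mulfV // mul1r.
  by move=> x Lx; rewrite evM hL // gL.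
- by move=> g gL; rewrite fP // exprMn exprVn -ev_exp // BP bP // mulfK.
Qed.

Lemma lift_character (c : GG -> Omega) (e : seq Omega) :
    {morph c : g h / (g * h)%g >-> g * h} -> (forall g, c g ^+ p = 1) ->
    {subset e <= Lp} -> (forall g, {in e, ev g =1 id} -> c g = 1) ->
  exists (C : GG -> mu Lp m) (e' : seq Omega), [/\ {subset e' <= Lp},
    forall g, {in e', ev g =1 id} -> C g = 1%g,
    forall g h, C (g * h)%g = (C g * twisted_action g (C h))%g
    & forall g, mu_root (C g) ^+ q = c g].
Proof.
move=> cM cp eLp ce.
have [B [f [LB fB fM fc]]] := kummer_cocycle cM cp eLp ce.
have [z zP] := prim_root_exists p_neq0.
have Lz : z \in L by apply: adjoin_roots_unity; apply: prim_expr_order.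
have [T [s [act [actP sinj copT]]]] := coset_representatives zP.
(* g s_t = s_(gt) r(g, t), with r(g, t) in G_L. *)
pose r g t := ((s (act g t))^-1 * (g * s t))%g.
have rL g t : {in L, ev (r g t) =1 id}.
  apply: (fix_adjoinE zP); apply: (can_inj (evK (s (act g t)))).
  by rewrite /r evM evVK evM actP.
have act_inj g : injective (act g).
  move=> t t' att; apply: sinj; apply: (@ev_inj _ _ _ g).
  by rewrite -!actP att.
have actM g h t : act (g * h)%g t = act g (act h t).
  by apply: sinj; rewrite !actP evM.
have rM g h t : r (g * h)%g t = (r g (act h t) * r h t)%g.
  by rewrite /r actM -!mulgA mulKVg.
(* The explicit formula for corestriction of a 1-cocycle. *)
pose C0 g := \prod_(t : T) mu_root (twisted_action (s (act g t)) (f (r g t))).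
have C0m g : C0 g ^+ m = 1.
  by rewrite /C0 -prodrXl big1 // => t _; rewrite mu_root_expm.
have /choice[C CP] : forall g, exists w, mu_root w = C0 g.
  by move=> g; apply: mu_root_surj.
have CM g h : C (g * h)%g = (C g * twisted_action g (C h))%g.
  apply: mu_root_inj; rewrite mu_rootM (twisted_action_prod _ (CP h)) !CP /C0.
  rewrite [X in _ = X * _](reindex_inj (@act_inj h)) /= -big_split /=.
  apply: eq_bigr => t _; rewrite -mu_rootM -twisted_actionM // rM fM // actM.
  rewrite -(twisted_action_fix_adjoin p_prime p_neq0 n_gt0 _ (rL g (act h t))).
  rewrite twisted_action_mul.
  rewrite -(twisted_actionM p_prime p_neq0 n_gt0 (s _) (r g (act h t))).
  by rewrite {2}/r mulKVg.
(* c(r(g, t)) = c(s_(gt))^-1 c(g) c(s_t), and over all t the outer factors cancel, because g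
   permutes T. *)
have Cq g : mu_root (C g) ^+ q = c g ^+ #|T|.
  have c0 h : c h != 0.
    apply/eqP => ch0; have /eqP := cp h.
    by rewrite ch0 expr0n gtn_eqF ?prime_gt0 // eq_sym oner_eq0.
  rewrite CP /C0 -prodrXl.
  have cs0 : \prod_(t : T) c (s t) != 0 by apply/prodf_neq0.
  apply: (mulfI cs0); rewrite {1}(reindex_inj (@act_inj g)) /= -big_split /=.
  rewrite -prodr_const mulrC -big_split /=; apply: eq_bigr => t _.
  by rewrite mu_epi_twisted fc // -cM /r mulKVg cM.
(* k inverts the number of cosets modulo p: k |T| = |T|^(p-1) is 1 modulo p. *)
pose k := (#|T| ^ p.-1.-1)%N.
(* If g fixes z, it fixes every coset, and r(g, t) is the conjugate s_t^-1 g s_t; if g also fixes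
   s_t(B), this conjugate fixes B, where f is trivial. *)
exists (fun g => (C g ^+ k)%g), (z :: [seq ev (s t) B | t : T]); split.
- move=> x; rewrite inE => /predU1P[->|/fintype.imageP[t _ ->]]; first exact: LLp.
  exact: ev_in.
- move=> g ge; have gz : ev g z = z by apply: ge; rewrite mem_head.
  suff -> : C g = 1%g by rewrite expg1n.
  apply: mu_root_inj; rewrite CP /C0 mu_root1 big1 // => t _.
  have szL : ev (s t) z \in L.
    apply: adjoin_roots_unity; rewrite -ev_exp ?LLp // prim_expr_order //.
    exact: ev_1.
  have gt : act g t = t by apply: sinj; rewrite actP (fix_adjoinE zP gz).
  rewrite fB ?twisted_action1 ?mu_root1 // /r gt !evM ge ?evK //.
  by rewrite inE fintype.image_f ?orbT.
- by move=> g h; rewrite CM mu_expgM twisted_actionX.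
- move=> g; rewrite mu_rootX exprAC Cq -exprM mulnC.
  have -> : (k * #|T| = #|T| ^ totient p)%N.
    by rewrite totient_prime // -(prednK (n := p.-1)) ?expnSr // -ltnS prednK ?prime_gt0 ?prime_gt1.
  by rewrite -(expr_mod _ (cp g)) Euler_exp_totient // modn_small ?prime_gt1.
Qed.

End Transfer.

(** * Descent to Gal(F(p)/F) *)

Section Descent.
Variables (Omega : closedFieldType) (F : subfield Omega) (p : nat).
Hypotheses (p_prime : prime p) (p_neq0 : p%:R != 0 :> Omega).
Local Notation A := (alg_closure F).
Local Notation L := (adjoin_roots p F).
Local Notation Lp := (max_p_extension p L).
Local Notation Fp := (max_p_extension p F).
Local Notation GG := (gal Lp F).
Local Notation GF := (gal Fp F).
Implicit Types (g h u : GG) (s t : GF).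

Let FpLp : {subset Fp <= Lp}. Proof. exact: max_p_base_sub. Qed.

Lemma ev_lift s : {in Fp, ev (lift s) =1 ev s}.
Proof.
have [h hs] := gal_extend_alg (@base_max_p_sub _ F p) (max_p_base_alg p_prime p_neq0) s.
have [g gh] := gal_max_p_restrict p_prime p_neq0 h.
have lP : [set g : GG | forall (x : Lp) (y : Fp), val x = val y ->
                    val (g x) = val (s y)] (lift s).
  apply: (@xgetPex _ 1%g); exists g => x y xy.
  by rewrite -ev_val -ev_val xy gh ?FpLp ?elt_valP // hs ?elt_valP.
move=> x Fx; have Lx := FpLp Fx.
rewrite -[x in LHS]/(val (SubfieldElt Lx)) -[x in RHS]/(val (SubfieldElt Fx)) !ev_val.
exact: lP.
Qed.

Lemma gal_base_restrict g : exists s, {in Fp, ev s =1 ev g}.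
Proof.
have [h hg] := gal_max_p_extend p_prime p_neq0 g.
have [|s sh] := gal_restrict_stable (max_p_base_alg p_prime p_neq0) h (F := F).
  by move=> h' x; apply: max_p_base_stable.
by exists s => x Fx; rewrite sh // hg // FpLp.
Qed.

Lemma mem_map_elt (M : subfield Omega) (e : seq Omega) : {subset e <= M} ->
  exists e' : seq M, map val e' = e.
Proof.
elim: e => [|x e IHe] eM; first by exists [::].
have [y ey|e' <-] := IHe; first by apply: eM; rewrite inE ey orbT.
by have Mx := eM x (mem_head _ _); exists (SubfieldElt Mx :: e').
Qed.

Lemma near_galP (T : Type) (c : GF -> T) s (e : seq Omega) : {subset e <= Fp} ->
  (forall t, {in e, ev t =1 ev s} -> c t = c s) -> \forall t \near s, c t = c s.
Proof.
move=> /mem_map_elt[e' <-] ce; exists e' => t ts; apply: ce.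
by move=> _ /mapP[x e'x ->]; rewrite !ev_val ts.
Qed.

Lemma twisted_action_p1 g (w : mu Lp (p ^ 1)) : twisted_action g w = w.
Proof.
have [u uL ->] := twisted_action_decomposition p_prime p_neq0 (ltnSn 0) g.
apply: mu_root_inj; rewrite mu_root_gal uL //; apply: adjoin_roots_unity.
by have := mu_root_expm w; rewrite expn1.
Qed.

Lemma mu_root_epi n (n_gt0 : (0 < n)%N) (w : mu Lp (p ^ n)) :
  mu_root (mu_epi n_gt0 w) = mu_root w ^+ (p ^ n.-1).
Proof. by rewrite /mu_root rmorphXn. Qed.

(** Coboundaries die in mu_p, where the action is trivial, so all cocycles of a class have the same
    image. *)
Lemma mu_epi_coboundary n (n_gt0 : (0 < n)%N) g (v w : mu Lp (p ^ n)) :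
  mu_epi n_gt0 (v * (twisted_action g w * w^-1))%g = mu_epi n_gt0 v.
Proof.
apply: mu_root_inj; rewrite !mu_root_epi mu_rootM exprMn.
suff -> : mu_root (twisted_action g w * w^-1)%g ^+ (p ^ n.-1) = 1 by rewrite mulr1.
apply: (mulIf (expf_neq0 (p ^ n.-1) (mu_root_neq0 w))).
by rewrite -exprMn -mu_rootM mulgKV mu_epi_twisted // mul1r.
Qed.

Lemma lift_cocycle (n : nat) (n_gt0 : (0 < n)%N) (c : GF -> mu Lp (p ^ 1)) :
    is_cocycle (@twisted_mu_action Omega p F 1) c ->
  exists2 d, is_cocycle (@twisted_mu_action Omega p F n) d &
    forall s, mu_epi n_gt0 (d s) = c s.
Proof.
move=> [c_cont cM].
have {}cM s t : c (s * t)%g = (c s * c t)%g.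
  by rewrite cM /twisted_mu_action twisted_action_p1.
have c1 : c 1%g = 1%g by have /esym := cM 1%g 1%g; rewrite mulg1 -[RHS]mulg1 => /mulgI.
(* r is the restriction G -> G_F, along which c is inflated to G. *)
have /choice[r rP] := gal_base_restrict.
have rM g h : r (g * h)%g = (r g * r h)%g.
  apply: ev_ext => x Fx; have Fhx := ev_in (r h) Fx.
  by rewrite (rP _ _ Fx) !evM (rP g _ Fhx) (rP h _ Fx).
have rlift s : r (lift s) = s by apply: ev_ext => x Fx; rewrite rP // ev_lift.
pose c' g := mu_root (c (r g)).
have [e ce] := c_cont 1%g.
have [| | | |C [f [fLp fC CM Cq]]] := @lift_character _ F p n p_prime p_neq0 n_gt0 c' (map val e).
- by move=> g h; rewrite /c' rM cM mu_rootM.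
- by move=> g; have := mu_root_expm (c (r g)); rewrite expn1.
- by move=> _ /mapP[x _ ->]; rewrite FpLp ?elt_valP.
- move=> g ge; rewrite /c' ce ?c1 ?mu_root1 // => x ex; apply: val_inj.
  by rewrite -ev_val rP ?elt_valP // ge ?map_f.
have C1 : C 1%g = 1%g by apply: fC => x _; rewrite ev1.
(* The kernel of the morphism from G to the semidirect product of mu_(p^n) and its automorphisms
   given by C and the action. *)
pose U := [set g | C g = 1%g /\ forall w : mu Lp (p ^ n), twisted_action g w = w].
have tw1 (w : mu Lp (p ^ n)) : twisted_action (1%g : GG) w = w.
  by rewrite twisted_action_fix_base // => x _; rewrite ev1.
have U1 : U 1%g by split.
have UM g h : U g -> U h -> U (g * h)%g.
  move=> [Cg tg] [Ch th]; split=> [|w]; first by rewrite CM tg Cg Ch mulg1.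
  by rewrite twisted_actionM // th tg.
have UV g : U g -> U g^-1%g.
  move=> [Cg tg]; have tV (w : mu Lp (p ^ n)) : twisted_action g^-1%g w = w.
    by rewrite -{1}(tg w) -twisted_actionM // mulVg tw1.
  by split=> //; have := CM g g^-1%g; rewrite mulgV C1 Cg mul1g tg => <-.
have UX g k : (forall w : mu Lp (p ^ n), twisted_action g w = w) ->
    C (g ^+ k)%g = (C g ^+ k)%g /\ forall w : mu Lp (p ^ n), twisted_action (g ^+ k)%g w = w.
  move=> tg; elim: k => [|k [IHC IHt]]; first by rewrite !expg0 C1.
  by rewrite !expgS; split=> [|w]; rewrite ?CM ?tg ?IHC // twisted_actionM // IHt tg.
(* A first p-power acts trivially; on its powers C is multiplicative, so a further p^n-th power
   kills C. *)
have Up g : exists a, U (g ^+ (p ^ a))%g.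
  have [a ga] := twisted_action_torsion p_prime p_neq0 n_gt0 g; exists (a + n)%N.
  have [Cg tg] := UX _ (p ^ n)%N ga; rewrite expnD expgM; split=> //.
  by rewrite Cg; apply: mu_root_inj; rewrite mu_rootX mu_root_expm mu_root1.
have [w wP] := mu_prim_root F p_prime p_neq0 n_gt0.
have [z zP] := prim_root_exists p_neq0.
have Lpz : z \in Lp by apply: unity_root_in_max_p; apply: prim_expr_order.
(* Fixing z puts g in G_L, where the twisted action is the Galois one; fixing the primitive root w
   makes that trivial, and fixing f gives C g = 1. *)
have [|g ge|e' e'Fp e'U] := @open_subgroup _ F p p_prime p_neq0 U (z :: mu_root w :: f) U1 UM UV _ _ Up.
- move=> x; rewrite in_cons => /predU1P[->//|].
  by rewrite in_cons => /predU1P[->|/fLp//]; apply: mu_root_in.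
- split=> [|w']; first by apply: fC => x fx; apply: ge; rewrite !inE fx !orbT.
  have gL : {in L, ev g =1 id} by apply: (fix_adjoinE zP); apply: ge; rewrite mem_head.
  rewrite twisted_action_fix_adjoin //; apply: mu_root_inj; rewrite mu_root_gal.
  have [k ->] := prim_rootP wP (mu_root_expm w').
  by rewrite ev_exp ?mu_root_in // ge // !inE eqxx orbT.
(* C sees only the action on F(p), so C at a lift of s does not depend on the lift. *)
have Cfix g h : {in e', ev g =1 ev h} -> C g = C h.
  move=> gh; have [Cu _] : U (h^-1 * g)%g.
    by apply: e'U => x e'x; rewrite evM gh // evK.
  by rewrite -(mulKVg h g) CM Cu; rewrite twisted_action1 mulg1.
exists (fun s => C (lift s)).
- split=> [s|s t].
    by apply: (near_galP e'Fp) => t ts; apply: Cfix => x /[dup] e'x /e'Fp Fx; rewrite !ev_lift // ts.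
  rewrite -[RHS]CM; apply: Cfix => x /e'Fp Fx.
  by rewrite evM !ev_lift ?evM // ev_in.
- move=> s; apply: mu_root_inj; rewrite -{2}(rlift s) -/(c' _) -Cq.
  by rewrite mu_root_epi.
Qed.

End Descent.

(** * Passage from cocycles to cohomology classes *)

Theorem corollary2p5 (p : nat) (p_prime : prime p) (p_odd : odd p)
  (F : fieldType) (Omega : closedFieldType) (iota : {rmorphism F -> Omega})
  (charF : p \notin [pchar F]%R)
  (muF : ~ ([set x : Omega | x ^+ p = 1] `<=` range iota)%R%classic)
  (n : nat) (n_gt0 : (0 < n)%N) :
  let F0 := image_subfield iota in
  let Lp := max_p_extension p (adjoin_roots p F0) in
  set_surj (H1 (@twisted_mu_action Omega p F0 n))
           (H1 (@twisted_mu_action Omega p F0 1))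
           (H1_map (@twisted_mu_action Omega p F0 1) (@mu_epi Lp p n n_gt0)).
Proof.
move=> F0 Lp.
have p_neq0 : p%:R != 0 :> Omega.
  move: charF; rewrite inE p_prime /=; apply: contra => /eqP p0.
  by rewrite -(fmorph_eq0 iota) rmorph_nat p0.
move=> _ [c cP <-]; have [d dP dc] := lift_cocycle p_prime p_neq0 n_gt0 cP.
exists (cohomology_class (@twisted_mu_action Omega p F0 n) d); first by exists d.
(* Every representative of the class of d maps to c itself, so the union in [H1_map] is the class of
   c. *)
have classE d' : cohomology_class (@twisted_mu_action Omega p F0 n) d d' ->
    mu_epi n_gt0 \o d' = c.
  move=> [_ [w d'E]]; apply/funext => s; rewrite -dc /= d'E.
  exact: mu_epi_coboundary.
apply/seteqP; split=> [x [d' d'd]|x cx]; first by rewrite classE.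
have dd : cohomology_class (@twisted_mu_action Omega p F0 n) d d.
  split=> //; exists 1%g => s.
  by rewrite /twisted_mu_action twisted_action1 mulgV mulg1.
by exists d; rewrite // classE.
Qed.
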